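(* Let $1<p<\infty$ and let $\Omega\subset\mathbb{T}_n$ be open. Let $f\colon\Omega\times\mathbb{R}^m\to\mathbb{R}$ be a measurable integrand such that, for constants $\nu,c$, $$|w|^p\le f(x,w)\le\nu|w|^p+c\qquad\text{for all }w\in\mathbb{R}^m\text{ and a.e. }x\in\Omega .$$ Suppose that the differential operator $\mathscr{A}$ satisfies the truncation property (TP) on $\mathbb{T}_n$ with exponent $p$ and constant $C(\mathscr{A})$. Suppose further that $\Omega$ satisfies the following extension property: there are constants $C_1,C_2,C_3>0$ (depending on $\Omega$) such that for any $v\in L^p(\Omega;\mathbb{R}^m)$ with $\mathscr{A}v=0$ in $\Omega$ there is an $\mathcal{E}v\in L^p(\mathbb{T}_n;\mathbb{R}^m)$ with $\mathcal{E}v=v$ a.e. in $\Omega$ and $\mathscr{A}(\mathcal{E}v)=0$ in $\mathbb{T}_n$ such that either $$\mathcal{L}^n(\{\mathscr{M}(\mathcal{E}v)\ge\lambda\})\le C_1\,\mathcal{L}^n(\{\mathscr{M}v\ge C_2\lambda\})\quad\text{for all }\lambda>0,$$ or $$\mathscr{M}(\mathcal{E}v)(x)\le C_3\,\mathscr{M}v(x)\quad\text{for a.e. }x\in\Omega .$$ Let $u\in L^p(\Omega;\mathbb{R}^m)$ be a minimiser, over $L^p(\Omega;\mathbb{R}^m)$, of $$I(u)=\begin{cases}\int_\Omega f(x,u(x))\,\mathrm{d}x&\text{if }\mathscr{A}u=0\text{ in }\Omega,\\ \infty&\text{else.}\end{cases}$$ Then there is an $\varepsilon_0=\varepsilon_0(p,C(\mathscr{A}),\nu,\Omega)>0$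 such that $u\in L^{p+\varepsilon}(\Omega;\mathbb{R}^m)$ for all $0<\varepsilon<\varepsilon_0$.
   Context: $\mathbb{T}_n$ is the $n$-dimensional torus $\mathbb{R}^n/\mathbb{Z}^n$; the dimensions $n,m,l$ are fixed. Measurability of $f$ is understood so that $x\mapsto f(x,v(x))$ is measurable for every measurable $v$. Dependence of $\varepsilon_0$ on $\Omega$ is through the constants $C_1,C_2,C_3$ of the extension property. $\mathscr{A}$ is a linear homogeneous constant-coefficient differential operator $\mathscr{A}u=\sum_{|\alpha|=k}A_\alpha\partial^\alpha u$ with linear maps $A_\alpha\colon\mathbb{R}^m\to\mathbb{R}^l$. The equation $\mathscr{A}u=0$ is understood in the distributional sense: $\int u\cdot\mathscr{A}^*\varphi\,\mathrm{d}x=0$ for all test functions $\varphi\in C^\infty(\mathbb{T}_n;\mathbb{R}^l)$ (on the torus), respectively $\varphi\in C_c^\infty(\Omega;\mathbb{R}^l)$ (on $\Omega$), where $\mathscr{A}^*\varphi=\sum_{|\alpha|=k}A_\alpha^T\partial^\alpha\varphi$. Maximal function: $\mathscr{M}u(x)=\sup_{r>0}\frac{1}{\mathcal{L}^n(B_r(x))}\int_{B_r(x)}|u|\,\mathrm{d}y$, where $u\in L^1(\mathbb{T}_n;\mathbb{R}^m)$ is regarded as a $\mathbb{Z}^n$-periodic function on $\mathbb{R}^n$. For $u\in L^1(\Omega;\mathbb{R}^m)$, $\mathscr{M}u$ is defined by first extending $u$ by $0$ to $\mathbb{T}_n$. Truncation property (TP) with exponent $p$: there is a constant $C(\mathscr{A})$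 such that for any $u\in L^p(\mathbb{T}_n;\mathbb{R}^m)$ with $\mathscr{A}u=0$ and any $\lambda>0$ there exists $\tilde u\in L^\infty(\mathbb{T}_n;\mathbb{R}^m)$ with $\mathscr{A}\tilde u=0$, $\|\tilde u\|_{L^\infty}\le C(\mathscr{A})\lambda$, and $\{u\neq\tilde u\}\subset\{\mathscr{M}u\ge\lambda\}$ (up to null sets). *)

(* Defs.v *)
From HB Require Import structures.
From mathcomp Require Import all_boot all_order all_algebra.
From mathcomp Require Import ring lra.
From mathcomp Require Import all_classical all_reals all_analysis.
Import Order.TTheory GRing.Theory Num.Theory.
Import numFieldNormedType.Exports.

Set Implicit Arguments.
Unset Strict Implicit.
Unset Printing Implicit Defensive.

Local Open Scope classical_set_scope.
Local Open Scope ring_scope.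

                                                        

Section lebesgue.
Context {R : realType} {n : nat}.
Notation Rn := 'rV[R]_n.+1.

Definition box (ab : Rn * Rn) : set Rn :=
  [set x | forall i, ab.1 0 i <= x 0 i < ab.2 0 i].

Definition box_vol (ab : Rn * Rn) : R :=
  \prod_i Num.max 0 (ab.2 0 i - ab.1 0 i).

Definition box_cover (X : set Rn) : set ((Rn * Rn)^nat) :=
  [set F | X `<=` \bigcup_k box (F k)].

Definition lebesgue_outer (X : set Rn) : \bar R :=
  ereal_inf [set (\sum_(k <oo) (box_vol (F k))%:E)%E | F in box_cover X].

Lemma box_vol_ge0 ab : 0 <= box_vol ab.
Proof. by apply: prodr_ge0 => i _; rewrite le_max lexx. Qed.

Lemma box_volE_ge0 ab : (0 <= (box_vol ab)%:E)%E.
Proof. by rewrite lee_fin box_vol_ge0. Qed.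

Lemma lebesgue_outer_ge0 X : (0 <= lebesgue_outer X)%E.
Proof.
apply: le_ereal_inf_tmp => _ [F _ <-].
by apply: nneseries_ge0 => k *; exact: box_volE_ge0.
Qed.

Lemma lebesgue_outer0 : lebesgue_outer set0 = 0%E.
Proof.
apply/eqP; rewrite eq_le lebesgue_outer_ge0 andbT.
apply: ereal_inf_lbound; exists (fun=> (0, 0)); first exact: sub0set.
apply: eseries0 => k _ _; rewrite /box_vol (bigD1 ord0)//=.
by rewrite subrr maxxx mul0r.
Qed.

Lemma le_lebesgue_outer : {homo lebesgue_outer : A B / A `<=` B >-> (A <= B)%E}.
Proof.
move=> A B AB; apply: ereal_inf_le_tmp => _ [F BF <-].
by exists F => //; exact: subset_trans BF.
Qed.

Lemma lebesgue_outer_sigma_subadditive : sigma_subadditive lebesgue_outer.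
Proof.
move=> A; have [[i ioo]|] := pselect (exists i, lebesgue_outer (A i) = +oo%E).
  rewrite (eseries_pinfty _ _ ioo) ?leey// => k _.
  by rewrite -ltNye (lt_le_trans _ (lebesgue_outer_ge0 _)).
rewrite -forallNE => Aoo.
apply/lee_addgt0Pr => e e0.
rewrite (le_trans _ (epsilon_trick _ _ (ltW e0)))//; last first.
  by move=> k; exact: lebesgue_outer_ge0.
pose P k (F : (Rn * Rn)^nat) := box_cover (A k) F /\
  (\sum_(j <oo) (box_vol (F j))%:E <=
   lebesgue_outer (A k) + (e / (2 ^ k.+1)%:R)%:E)%E.
have [G PG] : {G : ((Rn * Rn)^nat)^nat & forall k, P k (G k)}.
  apply: (@choice _ _ P) => k.
  have ek : 0 < e / (2 ^ k.+1)%:R by rewrite divr_gt0// ltr0n expn_gt0.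
  have Afin : lebesgue_outer (A k) \is a fin_num.
    by rewrite ge0_fin_numE ?lebesgue_outer_ge0// ltey; apply/eqP/Aoo.
  have [_ [F AF <-] /ltW Fe] := lb_ereal_inf_adherent ek Afin.
  by exists F.
pose vol2 ij := (box_vol (uncurry G ij))%:E.
have vol2_ge0 ij : (0 <= vol2 ij)%E by exact: box_volE_ge0.
apply: (@le_trans _ _ (\esum_(ij in setT) vol2 ij)%E).
  apply: ereal_inf_lbound => /=.
  have /card_esym/ppcard_eqP[f] := card_nat2.
  exists (uncurry G \o f).
    move=> x [i _ /(PG i).1[j _ Gx]]; exists (f^-1%FUN (i, j)) => //=.
    by rewrite invK ?inE.
  rewrite -(esum_pred_image vol2 _ xpredT) ?[fun=> _]set_true//.
  by rewrite image_eq.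
rewrite (_ : esum _ _ = \sum_(i <oo) \sum_(j <oo) vol2 (i, j))%E; last first.
  pose J : nat -> set (nat * nat) := fun i => [set (i, j) | j in setT].
  rewrite (_ : setT = \bigcup_k J k); last first.
    by rewrite predeqE => -[a b]; split => // _; exists a => //; exists b.
  rewrite esum_bigcupT//=; last first.
    apply/trivIsetP => i j _ _ ij.
    rewrite predeqE => -[a b] /=; split => //= -[] [_] _ [<-{a} _].
    by move=> [m' _] [] /esym/eqP; rewrite (negbTE ij).
  rewrite -(image_id [set: nat]) -fun_true esum_pred_image//; last first.
    by move=> k _; exact: esum_ge0.
  apply: eq_eseriesr => /= j _.
  rewrite -(esum_pred_image vol2 (pair j) predT)//=; last first.
    by move=> ? ? _ _; exact: (@can_inj _ _ _ snd).
  by congr esum; rewrite predeqE => -[a b]; split; move=> [i _ <-]; exists i.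
by apply: lee_nneseries => [i _ _|i _]; [exact: nneseries_ge0 | exact: (PG i).2].
Qed.

HB.instance Definition _ := isOuterMeasure.Build R Rn lebesgue_outer
  lebesgue_outer0 lebesgue_outer_ge0 le_lebesgue_outer
  lebesgue_outer_sigma_subadditive.

                                                                              
Definition lebesgue_space := caratheodory_type lebesgue_outer.

HB.instance Definition _ := Measurable.on lebesgue_space.

Definition lebesgue_Rn : set lebesgue_space -> \bar R := lebesgue_outer.

HB.instance Definition _ := isMeasure.Build _ lebesgue_space R lebesgue_Rn
  (@caratheodory_measure0 _ _ lebesgue_outer)
  (@caratheodory_measure_ge0 _ _ lebesgue_outer)
  (@caratheodory_measure_sigma_additive _ _ lebesgue_outer).

Lemma measurable_halfspace (i : 'I_n.+1) (c : R) :
  measurable ([set x | c <= x 0 i] : set lebesgue_space).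
Proof.
apply: le_caratheodory_measurable => X.
apply: le_ereal_inf_tmp => _ [F XF <-].
pose up (ab : Rn * Rn) : Rn * Rn :=
  (\row_j (if j == i then Num.max (ab.1 0 j) c else ab.1 0 j), ab.2).
pose low (ab : Rn * Rn) : Rn * Rn :=
  (ab.1, \row_j (if j == i then Num.min (ab.2 0 j) c else ab.2 0 j)).
have volE ab : box_vol ab = box_vol (up ab) + box_vol (low ab).
  rewrite /box_vol (bigD1 i)//= [X in _ = X + _](bigD1 i)//=.
  rewrite [X in _ = _ + X](bigD1 i)//= !mxE eqxx.
  rewrite [X in _ = _ * X + _](eq_bigr (fun j => Num.max 0 (ab.2 0 j - ab.1 0 j))).
    rewrite [X in _ = _ + _ * X](eq_bigr (fun j => Num.max 0 (ab.2 0 j - ab.1 0 j))).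
      rewrite -mulrDl; congr (_ * _).
      set a := ab.1 0 i; set b := ab.2 0 i.
      have [ac|ac] := leP a c; have [bc|bc] := leP b c; rewrite ?/Num.max;
        repeat case: ifPn; lra.
    by move=> j /negbTE ji; rewrite mxE ji.
  by move=> j /negbTE ji; rewrite mxE ji.
under eq_eseriesr do rewrite volE EFinD.
rewrite nneseriesD; [|by move=> *; exact: box_volE_ge0..].
apply: leeD; apply: ereal_inf_lbound.
- exists (up \o F) => // x [/XF[k _ Fx] cx]; exists k => // j /=.
  have := Fx j; rewrite mxE; case: eqP => [->|//] /andP[h1 h2].
  by rewrite ge_max h1 h2 andbT; exact: cx.
- exists (low \o F) => // x [/XF[k _ Fx] cx]; exists k => // j /=.
  have := Fx j; rewrite mxE; case: eqP => [->|//] /andP[h1 h2].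
  by rewrite lt_min h1 h2/= ltNge; exact/negP.
Qed.

Lemma measurable_box (a b : Rn) :
  measurable (box (a, b) : set lebesgue_space).
Proof.
rewrite (_ : box _ = \bigcap_(i in [set: 'I_n.+1])
    ([set x | a 0 i <= x 0 i] `&` ~` [set x | b 0 i <= x 0 i])).
  apply: fin_bigcap_measurable => // i _; apply: measurableI.
    exact: measurable_halfspace.
  by apply: measurableC; exact: measurable_halfspace.
apply/seteqP; split => x /= xab i.
- by move=> _; have /andP[h1 h2] := xab i; split=> //; apply/negP; rewrite -ltNge.
- by have [// h1 /negP] := xab i I; rewrite -ltNge h1 => ->.
Qed.

End lebesgue.
Arguments lebesgue_space : clear implicits.

Section torus.
Context {R : realType} {n : nat}.
Notation Rn := 'rV[R]_n.+1.

                                                                       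
                                                                                
                                                                          
                                                                         
                                                                          
                               
Definition Zn_periodic (T : Type) (g : Rn -> T) : Prop :=
  forall (x : Rn) (z : 'rV[int]_n.+1), g (x + map_mx intr z) = g x.

Definition Zn_periodic_set (Omega : set Rn) : Prop :=
  forall (x : Rn) (z : 'rV[int]_n.+1), Omega (x + map_mx intr z) <-> Omega x.

Definition cell : set Rn := box (0, const_mx 1).

Lemma measurable_cell : measurable (cell : set (lebesgue_space R n)).
Proof. exact: measurable_box. Qed.

Definition torus_measure : {measure set (lebesgue_space R n) -> \bar R} :=
  mrestr lebesgue_Rn measurable_cell.

End torus.

Section euclidean.
Context {R : realType} {d : nat}.

                                                      
Definition dotp (v w : 'rV[R]_d) : R := \sum_i v 0 i * w 0 i.

Definition enorm (v : 'rV[R]_d) : R := Num.sqrt (dotp v v).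

Definition eball (x : 'rV[R]_d) (r : R) : set 'rV[R]_d :=
  [set y | enorm (y - x) < r].

End euclidean.

Section function_spaces.
Context {R : realType} {n : nat}.
Notation Rn := 'rV[R]_n.+1.

Definition vmeasurable (d : nat) (Omega : set Rn) (v : Rn -> 'rV[R]_d) : Prop :=
  forall j, measurable_fun (Omega : set (lebesgue_space R n))
    (fun x => v x 0 j).

Definition LpNorm (d : nat) (Omega : set Rn) (p : \bar R) (v : Rn -> 'rV[R]_d) :
    \bar R :=
  Lnorm torus_measure p (patch (fun=> 0%E) Omega (fun x => (enorm (v x))%:E)).

Definition inLp (d : nat) (Omega : set Rn) (p : \bar R) (v : Rn -> 'rV[R]_d) :
    Prop :=
  [/\ Zn_periodic v, vmeasurable Omega v & (LpNorm Omega p v < +oo)%E].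

Definition maximal (d : nat) (v : Rn -> 'rV[R]_d) (x : Rn) : \bar R :=
  ereal_sup [set ((lebesgue_Rn (eball x r))^-1 *
                  \int[lebesgue_Rn]_(y in eball x r) (enorm (v y))%:E)%E
            | r in `]0, +oo[ ].

Definition maximal_on (d : nat) (Omega : set Rn) (v : Rn -> 'rV[R]_d) :
    Rn -> \bar R :=
  maximal (patch (fun=> 0) Omega v).

End function_spaces.

Section smooth_functions.
Context {R : realType} {n : nat}.
Notation Rn := 'rV[R]_n.+1.

Definition partials (s : seq 'I_n.+1) (g : Rn -> R) : Rn -> R :=
  foldr (fun i (h : Rn -> R) x => 'D_(delta_mx 0 i) h x) g s.

Definition smooth (g : Rn -> R) : Prop :=
  forall s, continuous (partials s g) /\
    forall i x, derivable (partials s g) x (delta_mx 0 i).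

Definition multi_index (k : nat) := {ffun 'I_n.+1 -> 'I_k.+1}.

Definition mderiv (k : nat) (alpha : multi_index k) (g : Rn -> R) : Rn -> R :=
  partials (flatten [seq nseq (alpha i) i | i <- enum 'I_n.+1]) g.

                                                                              
                           
Definition test_function (l : nat) (Omega : set Rn) (phi : Rn -> 'rV[R]_l) :
    Prop :=
  [/\ Zn_periodic phi,
      forall j, smooth (fun x => phi x 0 j) &
      closure [set x | phi x <> 0] `<=` Omega].

End smooth_functions.
Arguments multi_index : clear implicits.

Section operator.
Context {R : realType} {n m l k : nat}.
Notation Rn := 'rV[R]_n.+1.

                                                                             
                                                                            
                                                                 
Implicit Type A : multi_index n k -> 'M[R]_(m, l).

Definition adjoint_op A (phi : Rn -> 'rV[R]_l) (x : Rn) : 'rV[R]_m :=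
  \sum_(alpha : multi_index n k | (\sum_i alpha i == k)%N)
    (\row_j mderiv alpha (fun y => phi y 0 j) x) *m (A alpha)^T.

Definition A_free A (Omega : set Rn) (u : Rn -> 'rV[R]_m) : Prop :=
  forall phi : Rn -> 'rV[R]_l, test_function Omega phi ->
    (\int[torus_measure]_(x in Omega) (dotp (u x) (adjoint_op A phi x))%:E = 0)%E.

Definition truncation_property A (p C : R) : Prop :=
  forall u : Rn -> 'rV[R]_m, inLp setT p%:E u -> A_free A setT u ->
  forall lambda : R, 0 < lambda ->
  exists ut : Rn -> 'rV[R]_m,
    [/\ inLp setT +oo%E ut,
        A_free A setT ut,
        (LpNorm setT +oo ut <= (C * lambda)%:E)%E &
        {ae torus_measure, forall x, u x <> ut x -> (lambda%:E <= maximal u x)%E}].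

Definition extension_property A (p : R) (Omega : set Rn) (C1 C2 C3 : R) : Prop :=
  forall v : Rn -> 'rV[R]_m, inLp Omega p%:E v -> A_free A Omega v ->
  exists Ev : Rn -> 'rV[R]_m,
    [/\ inLp setT p%:E Ev,
        {ae torus_measure, forall x, Omega x -> Ev x = v x},
        A_free A setT Ev &
        (forall lambda : R, 0 < lambda ->
          (torus_measure [set x | lambda%:E <= maximal Ev x] <=
           C1%:E * torus_measure
             [set x | (C2 * lambda)%:E <= maximal_on Omega v x])%E) \/
        {ae torus_measure, forall x, Omega x ->
          (maximal Ev x <= C3%:E * maximal_on Omega v x)%E}].

                                                                               
                                                   
Definition integrand (Omega : set Rn) (f : Rn -> 'rV[R]_m -> R) : Prop :=
  Zn_periodic f /\
  forall v : Rn -> 'rV[R]_m, Zn_periodic v -> vmeasurable Omega v ->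
    measurable_fun (Omega : set (lebesgue_space R n)) (fun x => f x (v x)).

Definition growth (Omega : set Rn) (f : Rn -> 'rV[R]_m -> R) (p nu c : R) :
    Prop :=
  {ae torus_measure, forall x, Omega x -> forall w,
    enorm w `^ p <= f x w <= nu * enorm w `^ p + c}.

Definition functional A (Omega : set Rn) (f : Rn -> 'rV[R]_m -> R)
    (u : Rn -> 'rV[R]_m) : \bar R :=
  if `[< A_free A Omega u >]
  then (\int[torus_measure]_(x in Omega) (f x (u x))%:E)%E
  else +oo%E.

Definition minimiser A (Omega : set Rn) (f : Rn -> 'rV[R]_m -> R) (p : R)
    (u : Rn -> 'rV[R]_m) : Prop :=
  inLp Omega p%:E u /\
  forall w, inLp Omega p%:E w ->
    (functional A Omega f u <= functional A Omega f w)%E.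

End operator.

(* Main.v *)
(** Let [u] be a minimiser, extend it to the torus and truncate the extension at
    height [lam]. The truncation is an admissible competitor which differs from
    [u] only where the maximal function exceeds [lam], so minimality and growth
    bound the integral of [|u|^p] over [{|u| > C lam}] by [lam^p] times the
    measure of [{M u >= b0 lam}]. By the weak-type estimate this is at most
    [K lam^(p-1)] times the integral of [|u|] over [{|u| > b lam}]. Summing these
    inequalities over dyadic [lam] with weights [lam^eps] gives, as in Gehring's
    lemma, an inequality whose right-hand side can be absorbed when [eps] is
    small depending only on [K], [C / b] and [p]; the constant [c] only affects the
    smallest [lam] for which the inequality is used.

    The constructed Lebesgue measure is not shown to be nonzero: if it vanishes,
    the statement is trivial. *)
Require Import Defs.
From HB Require Import structures.
From mathcomp Require Import all_boot all_order all_algebra.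
From mathcomp Require Import ring lra.
From mathcomp Require Import all_classical all_reals all_analysis.
From mathcomp Require Import measurable_realfun ess_sup_inf.
Import Order.TTheory GRing.Theory Num.Theory.
Import numFieldNormedType.Exports.

Set Implicit Arguments.
Unset Strict Implicit.
Unset Printing Implicit Defensive.

Local Open Scope classical_set_scope.
Local Open Scope ring_scope.

(** * Lebesgue measure on R^n *)

Section lebesgue_measure_Rn.
Context {R : realType} {n : nat}.
Notation Rn := 'rV[R]_n.+1.
Notation L := (lebesgue_space R n).

(** The map carries boxes to boxes and scales each of the [n.+1] sides by [t], so a cover of [X]
    becomes a cover of its image. *)
Lemma lebesgue_outer_affine (t : R) (a : Rn) (X : set Rn) : 0 < t ->
  (lebesgue_outer [set (t *: x + a)%R | x in X] <=
   (t ^+ n.+1)%:E * lebesgue_outer X)%E.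
Proof.
move=> t0; rewrite -lee_pdivrMl ?exprn_gt0//.
apply: le_ereal_inf_tmp => _ [F XF <-].
rewrite lee_pdivrMl ?exprn_gt0// -nneseriesZl; last first.
  by move=> *; exact: box_volE_ge0.
apply: ereal_inf_lbound.
exists (fun k => (t *: (F k).1 + a, t *: (F k).2 + a)).
  move=> _ [x /XF[k _ Fx] <-]; exists k => // i; rewrite /= !mxE.
  by rewrite lerD2r ltrD2r ler_pM2l// ltr_pM2l//; exact: Fx.
apply: eq_eseriesr => k _; rewrite -EFinM; congr EFin.
rewrite /box_vol -[X in _ ^+ X]card_ord -prodr_const -big_split.
apply: eq_bigr => i _ /=; rewrite !mxE opprD addrACA subrr addr0 -mulrBr.
by rewrite maxr_pMr ?mulr0// ltW.
Qed.

Lemma lebesgue_outer_translate (a : Rn) (X : set Rn) :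
  lebesgue_outer [set x + a | x in X] = lebesgue_outer X.
Proof.
have le (b : Rn) (Y : set Rn) :
    (lebesgue_outer [set (x + b)%R | x in Y] <= lebesgue_outer Y)%E.
  have := lebesgue_outer_affine b Y (@ltr01 R).
  rewrite expr1n mul1e; congr (lebesgue_outer _ <= _)%E.
  by apply: eq_imagel => x _; rewrite scale1r.
apply/eqP; rewrite eq_le le /=.
rewrite [leLHS](_ : _ = lebesgue_outer [set x - a | x in [set x + a | x in X]]).
  exact: le.
congr lebesgue_outer; rewrite image_comp -[LHS]image_id.
by apply: eq_imagel => x _ /=; rewrite addrK.
Qed.

(** Carathéodory's criterion for the preimage, tested on [X], is the criterion for [B] tested on the
    translate of [X]. *)
Lemma measurable_translation (a : Rn) :
  measurable_fun [set: L] ((fun x : Rn => x + a) : L -> L).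
Proof.
move=> _ B mB; rewrite setTI.
have cB : lebesgue_outer.-caratheodory B by [].
suff : lebesgue_outer.-caratheodory ((fun x : Rn => x + a) @^-1` B) by [].
move=> X.
have pre (Y : set Rn) : [set x + a | x in (fun x : Rn => x + a) @^-1` Y] = Y.
  apply/seteqP; split=> [_ [x Yx <-]//|x Yx].
  by exists (x - a); rewrite /= ?subrK.
rewrite -(lebesgue_outer_translate a X) (cB _).
rewrite -(lebesgue_outer_translate a (X `&` _)).
rewrite -(lebesgue_outer_translate a (X `&` ~` _)); 
congr (_ + _)%E; congr lebesgue_outer.
- apply/seteqP; split=> [_ [[x Xx <-] Bx]|_ [x [Xx Bx] <-]].
    by exists x.
  by split => //; exists x.
- apply/seteqP; split=> [_ [[x Xx <-] Bx]|_ [x [Xx Bx] <-]].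
    by exists x.
  by split => //; exists x.
Qed.

Lemma lebesgue_Rn_box (a b : Rn) : (lebesgue_Rn (box (a, b)) < +oo)%E.
Proof.
apply: (@le_lt_trans _ _ (box_vol (a, b))%:E); last exact: ltry.
apply: ereal_inf_lbound.
(* The box itself, followed by degenerate boxes; these have volume zero because the dimension is at
   least one. *)
exists (fun k => if k == 0%N then (a, b) else (0, 0) : Rn * Rn).
  by move=> x xab; exists 0%N.
rewrite (nneseries_split _ 1); last by move=> *; exact: box_volE_ge0.
rewrite big_nat1 eseries0 ?adde0// => -[//|k] _ _.
by rewrite /box_vol (bigD1 ord0)//= subrr maxxx mul0r.
Qed.

Lemma measurable_coord (i : 'I_n.+1) :
  measurable_fun [set: L] (fun x : Rn => x 0 i).
Proof.
apply: (measurability _ (RGenCInfty.measurableE R)) => //.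
move=> _ [_ [c ->] <-]; rewrite setTI.
have -> : (fun x : Rn => x 0 i) @^-1` `[c, +oo[ = [set x | c <= x 0 i].
  by apply/seteqP; split => x /=; rewrite in_itv/= andbT.
exact: measurable_halfspace.
Qed.

Lemma measurable_ball (x : Rn) r : measurable (ball x r : set L).
Proof.
have [r0|r0] := leP r 0.
  rewrite (_ : ball _ _ = set0); first exact: measurable0.
  by apply/seteqP; split=> // y [] /(le_lt_trans r0); rewrite ltxx.
rewrite (_ : ball x r = \bigcap_(i in [set: 'I_n.+1])
   ((fun y : Rn => y 0 i) @^-1` `]x 0 i - r, x 0 i + r[)).
  apply: fin_bigcap_measurable => // i _; rewrite -[X in measurable X]setTI.
  exact: measurable_coord.
apply/seteqP; split => y.
  by case=> _ xy i _ /=; rewrite in_itv/= -ltr_distlC; exact: xy.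
move=> xy; split=> // j i; rewrite ord1; have := xy i I.
by rewrite /= in_itv/= -ltr_distlC.
Qed.

(** An open set is the union of the countably many sup-norm balls with rational centre and radius
    that it contains. *)
Lemma measurable_open (U : set Rn) : open U -> measurable (U : set L).
Proof.
move=> oU.
pose q (z : 'rV[rat]_n.+1 * rat) : set Rn := ball (map_mx ratr z.1 : Rn) (ratr z.2).
pose F k : set L := if unpickle k is Some z then
  if `[< q z `<=` U >] then q z else set0 else set0.
have -> : U = \bigcup_k F k.
  apply/seteqP; split=> [x Ux|x [k _]]; last first.
    by rewrite /F; case: (unpickle k) => // z; case: asboolP => // qU /qU.
  have /nbhs_ballP[e /= e0 xeU] : nbhs x U by exact: open_nbhs_nbhs.
  (* With radius below [e / 2] and centre closer to [x] than the radius, the rational ball contains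
     [x] and stays in [ball x e]. *)
  have [s] : exists s, ratr s \in `]0, e / 2[ by apply/rat_in_itvoo/divr_gt0.
  rewrite in_itv/= => /andP[s0 se].
  have /(_ _)/cid - /all_sig[y yP] i :
      exists y, ratr y \in `]x 0 i - ratr s, x 0 i + ratr s[.
    by apply/rat_in_itvoo; rewrite ltrD2l gtrN.
  have xy : ball x (ratr s) (map_mx ratr (\row_i y i) : Rn).
    split=> // j i; rewrite ord1 !mxE; have := yP i.
    by rewrite in_itv/= -ltr_distlC.
  exists (pickle (\row_i y i, s)) => //; rewrite /F pickleK.
  case: asboolP => [_|]; first exact: ball_sym.
  case; rewrite /q/= => w yw; apply: xeU.
  have := ball_triangle xy yw; apply: le_ball.
  by rewrite /= ltW// [ltRHS](splitr e) ltrD.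
apply: bigcup_measurable => k _; rewrite /F.
case: unpickle => [z|]; last exact: measurable0.
by case: asboolP => _; [exact: measurable_ball|exact: measurable0].
Qed.

Lemma measurable_enorm {d : nat} (D : set L) (v : Rn -> 'rV[R]_d) :
  vmeasurable D v -> measurable_fun D (fun x => enorm (v x)).
Proof.
move=> mv.
apply: (measurableT_comp (continuous_measurable_fun (@sqrt_continuous R))).
by apply: measurable_sum => i; apply: measurable_funM; exact: mv.
Qed.

Lemma measurable_eball (x : Rn) r : measurable (eball x r : set L).
Proof.
have m : measurable_fun [set: L] (fun y => enorm (y - x)).
  apply: measurable_enorm => j.
  under eq_fun do rewrite !mxE.
  apply: measurable_funB; [exact: measurable_coord|exact: measurable_cst].
rewrite (_ : eball x r = [set: L] `&` (fun y => enorm (y - x)) @^-1` `]-oo, r[).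
  exact: m.
by rewrite setTI; apply/seteqP; split => y /=; rewrite in_itv.
Qed.

Lemma enormZ {d : nat} (t : R) (v : 'rV[R]_d) : enorm (t *: v) = `|t| * enorm v.
Proof.
rewrite /enorm -sqrtr_sqr -sqrtrM ?sqr_ge0//; congr Num.sqrt.
by rewrite /dotp mulr_sumr; apply: eq_bigr => i _; rewrite !mxE; ring.
Qed.

Lemma coord_le_enorm {d : nat} (v : 'rV[R]_d) i : `|v 0 i| <= enorm v.
Proof.
rewrite -sqrtr_sqr ler_wsqrtr// /dotp (bigD1 i)//= -expr2 lerDl.
by apply: sumr_ge0 => j _; rewrite -expr2 sqr_ge0.
Qed.

Lemma enorm_le_coord {d : nat} (v : 'rV[R]_d) r :
  (forall i, `|v 0 i| <= r) -> enorm v <= d%:R * r.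
Proof.
(* For [d = 0] the bound [r] may be negative, but both sides vanish. *)
case: d v => [v _|d v vr].
  by rewrite /enorm /dotp big_ord0 sqrtr0 mul0r.
have r0 : 0 <= r by exact: le_trans (vr ord0).
rewrite -[leRHS]ger0_norm ?mulr_ge0// -sqrtr_sqr ler_wsqrtr//.
apply: (@le_trans _ _ (\sum_(i < d.+1) r ^+ 2)).
  apply: ler_sum => i _; rewrite -expr2 -(real_normK (num_real _)).
  by rewrite lerXn2r// nnegrE.
rewrite sumr_const card_ord exprMn -[leLHS]mulr_natl ler_wpM2r ?sqr_ge0//.
by rewrite -natrX ler_nat expnS expn1 leq_pmulr.
Qed.

Lemma eball_sub_ball (x : Rn) r : 0 < r -> eball x r `<=` ball x r.
Proof.
move=> r0 y xy; split => // i j; rewrite ord1 /ball/= distrC.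
by have := le_lt_trans (coord_le_enorm _ j) xy; rewrite !mxE.
Qed.

Lemma ball_sub_eball (x : Rn) r : ball x r `<=` eball x (n.+2%:R * r).
Proof.
move=> y [r0 xy]; rewrite /eball/=.
(* [n.+2] in place of [n.+1] makes the inequality strict, as [eball] demands. *)
apply: (@le_lt_trans _ _ (n.+1%:R * r)); last by rewrite ltr_pM2r// ltr_nat.
apply: enorm_le_coord => i; rewrite !mxE distrC ltW//; exact: xy.
Qed.

(** The larger ball is the image of the smaller one under the homothety of ratio [k] centred at
    [x]. *)
Lemma lebesgue_eball_scale (x : Rn) (k r : R) : 0 < k ->
  (lebesgue_Rn (eball x (k * r)) <= (k ^+ n.+1)%:E * lebesgue_Rn (eball x r))%E.
Proof.
move=> k0; apply: le_trans (lebesgue_outer_affine ((1 - k) *: x) _ k0).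
apply: le_lebesgue_outer => y xy.
exists (k^-1 *: (y - (1 - k) *: x)); last first.
  by rewrite scalerA mulfV ?gt_eqF// scale1r subrK.
rewrite /eball/= -(ltr_pM2l k0) -{1}(gtr0_norm k0) -enormZ.
rewrite [X in enorm X](_ : _ = y - x)//.
by apply/rowP => i; rewrite !mxE; field; rewrite gt_eqF.
Qed.

Lemma lebesgue_Rn_ball (x : Rn) r : (lebesgue_Rn (ball x r) < +oo)%E.
Proof.
apply: le_lt_trans (lebesgue_Rn_box (x - const_mx r) (x + const_mx r)).
apply: le_lebesgue_outer => y [r0 xy] i; rewrite /= !mxE.
have := xy 0 i; rewrite /ball/= ltr_distlC => /andP[h1 h2].
by rewrite (ltW h1) h2.
Qed.

End lebesgue_measure_Rn.

(** * Integrals of periodic functions over cells and cubes *)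

Section periodic_integrals.
Context {R : realType} {n : nat}.
Notation Rn := 'rV[R]_n.+1.
Notation L := (lebesgue_space R n).
Local Notation mu := (@lebesgue_Rn R n : {measure set L -> \bar R}).
Local Notation cube M := (box (const_mx (- M%:R), const_mx M%:R) : set L).

Lemma integral_torus (D : set L) (f : L -> \bar R) : measurable D ->
  measurable_fun D f -> (forall x, D x -> (0 <= f x)%E) ->
  (\int[torus_measure]_(x in D) f x = \int[mu]_(x in D `&` cell) f x)%E.
Proof.
move=> mD mf f0; have mC := @measurable_cell R n.
have mu0 : torus_measure (~` (cell : set L)) = 0%E.
  by rewrite [LHS](_ : _ = mu (~` (cell : set L) `&` cell)) // setICl measure0.
rewrite (ge0_negligible_integral _ mD mf f0 mu0); last exact: measurableC.
rewrite setDE setCK; apply: eq_measure_integral => A mA AC.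
rewrite [LHS](_ : _ = mu (A `&` (cell : set L)))//.
by rewrite setIidl// => x /AC[].
Qed.

(** Change of variables along the translation: invariance identifies the pushforward of [mu] with
    [mu], and periodicity leaves [h] unchanged. *)
Lemma integral_cell_translate (h : Rn -> \bar R) (z : 'rV[int]_n.+1) :
  measurable_fun [set: L] h -> (forall x, (0 <= h x)%E) -> Zn_periodic h ->
  (\int[mu]_(x in [set x : Rn | cell (x - map_mx intr z)%R]) h x =
   \int[mu]_(x in cell) h x)%E.
Proof.
move=> mh h0 hper; pose a : Rn := - map_mx intr z.
have mC := @measurable_cell R n.
have mphi := @measurable_translation R n a.
have h0' : {in (cell : set L), forall x, (0 <= h x)%E} by move=> x _; exact: h0.
have := ge0_integral_pushforward mphi mu mC (measurable_funTS mh) h0'.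
rewrite [X in _ = X -> _](_ : _ =
    (\int[mu]_(x in [set x : Rn | cell (x - map_mx intr z)%R]) h x)%E).
  move=> <-; apply: eq_measure_integral => A mA _.
  transitivity (lebesgue_outer [set x - a | x in (A : set Rn)]); last first.
    exact: lebesgue_outer_translate.
  congr (lebesgue_outer _); apply/seteqP; split => [x Ax|_ [x Ax <-]].
    by exists (x + a) => //; rewrite addrK.
  by rewrite /= subrK.
apply: eq_integral => x _ /=.
by rewrite -[in RHS](subrK (map_mx intr z) x) hper.
Qed.

(** The cube of side [2 * M] is a disjoint union of integer translates of the cell, indexed by their
    corners [t i - M]. *)
Lemma integral_cube_periodic (h : Rn -> \bar R) (M : nat) :
  measurable_fun [set: L] h -> (forall x, (0 <= h x)%E) -> Zn_periodic h ->
  (\int[mu]_(x in cube M) h x =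
   ((2 * M) ^ n.+1)%:R%:E * \int[mu]_(x in cell) h x)%E.
Proof.
move=> mh h0 hper.
pose z (t : {ffun 'I_n.+1 -> 'I_(2 * M)}) : 'rV[int]_n.+1 :=
  \row_i ((t i : nat)%:Z - M%:Z).
pose F t : set L := [set x : Rn | cell (x - map_mx intr (z t))].
have FP t (x : Rn) : F t x <->
    forall i, (t i : nat)%:R - M%:R <= x 0 i < (t i : nat).+1%:R - M%:R.
  rewrite /F/=; split => + i => /(_ i); rewrite /= !mxE rmorphB/=.
    by rewrite -!pmulrn subr_ge0 ltrBlDr addrA nat1r.
  by rewrite -!pmulrn subr_ge0 ltrBlDr addrA nat1r.
have -> : cube M = \big[setU/set0]_(t <- enum {ffun 'I_n.+1 -> 'I_(2 * M)}) F t.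
  rewrite -bigcup_seq; apply/seteqP; split => x.
    move=> xM.
    have ex i : exists j : 'I_(2 * M), (j : nat)%:R - M%:R <= x 0 i < j.+1%:R - M%:R.
      have /= := xM i; rewrite !mxE => /andP[h1 h2].
      have x0 : 0 <= x 0 i + M%:R by rewrite -lerBlDr sub0r.
      have tr := truncn_itv x0.
      have jM : (Num.truncn (x 0 i + M%:R)%R < 2 * M)%N.
        rewrite -(ltr_nat R); move/andP: tr => [+ _]; move/le_lt_trans; apply.
        by rewrite natrM mulr_natl mulr2n ltrD2r.
      by exists (Ordinal jM); rewrite /= lerBlDr ltrBrDr.
    have [t tP] := choice ex.
    exists (finfun t); first by rewrite /= mem_enum.
    by apply/FP => i; rewrite ffunE.
  case=> t _ /FP xt i; have := xt i; rewrite /= !mxE => /andP[h1 h2].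
  rewrite (le_trans _ h1) ?(lt_le_trans h2)//; last by rewrite lerBrDr addNr.
  rewrite lerBlDr -natrD ler_nat addnn -mul2n; exact: ltn_ord.
rewrite ge0_integral_bigsetU//=.
- under eq_bigr do rewrite integral_cell_translate//.
  rewrite big_const_seq count_predT -cardE card_ffun !card_ord.
  elim: (_ ^ _)%N => [|k ih]; first by rewrite mul0e.
  by rewrite iterS ih -nat1r EFinD ge0_muleDl ?mul1e.
- move=> t; rewrite -[X in measurable X]setTI.
  apply: (measurable_translation (- map_mx intr (z t))) => //.
  exact: measurable_cell.
- exact: enum_uniq.
- move=> s t _ _ [x [/FP xs /FP xt]]; apply/ffunP => i; apply/val_inj/eqP.
  have /andP[s1 s2] := xs i; have /andP[t1 t2] := xt i.
  have lt1 := le_lt_trans s1 t2; have lt2 := le_lt_trans t1 s2.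
  by rewrite eqn_leq -[X in X && _]ltnS -[X in _ && X]ltnS -!(ltr_nat R);
    move: lt1 lt2; rewrite !ltrD2r => -> ->.
- exact: measurable_funTS.
Qed.

End periodic_integrals.

(** * The weak-type estimate for the maximal function *)

Section vitali.
Context {R : realType} {n : nat}.
Notation Rn := 'rV[R]_n.+1.
Notation L := (lebesgue_space R n).
Local Notation mu := (@lebesgue_Rn R n : {measure set L -> \bar R}).
Local Notation balls s := (\bigcup_(b in [set` s]) (ball b.1 b.2 : set L)).

Lemma measurable_balls (s : seq (Rn * R)) : measurable (balls s).
Proof.
apply: fin_bigcup_measurable; first exact: finite_seq.
by move=> b _; exact: measurable_ball.
Qed.

(* Discard the balls meeting the largest one: they lie in its threefold
   enlargement, while the remaining ones are disjoint from it. *)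
Lemma vitali_measure_bound (h : L -> \bar R) (k : R) (s : seq (Rn * R)) :
  0 <= k -> measurable_fun [set: L] h -> (forall x, (0 <= h x)%E) ->
  (forall b, b \in s ->
    (mu (ball b.1 (3 * b.2)%R) <= k%:E * \int[mu]_(x in ball b.1 b.2) h x)%E) ->
  (mu (balls s) <= k%:E * \int[mu]_(x in balls s) h x)%E.
Proof.
move=> k0 mh h0.
have [m] := ubnP (size s); elim: m s => // m ih [_ _|b0 s0].
  rewrite set_nil bigcup_set0 measure0 mule_ge0//.
  by apply: integral_ge0.
have [b] : exists2 b, b \in b0 :: s0 & forall b', b' \in b0 :: s0 -> b'.2 <= b.2.
  elim: s0 b0 => [|b1 s0 ihs] b0.
    by exists b0; [exact: mem_head|move=> b'; rewrite inE => /eqP ->].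
  have [b bs bmax] := ihs b1; have [le|/ltW le] := leP b0.2 b.2.
    exists b; first by rewrite inE bs orbT.
    by move=> b'; rewrite inE => /orP[/eqP ->//|/bmax].
  exists b0; first exact: mem_head.
  move=> b'; rewrite inE => /orP[/eqP ->//|/bmax]; move/le_trans; exact.
move: (b0 :: s0) => {b0 s0} s bs bmax sm sk.
(* The test [b' != b] discards [b] even when its ball is empty, so the remaining list is strictly
   shorter. *)
pose far (b' : Rn * R) := (b' != b) && `[< ball b'.1 b'.2 `&` ball b.1 b.2 = set0 >].
pose t := [seq b' <- s | far b'].
have tm : (size t < m)%N.
  rewrite -ltnS; apply: leq_trans sm; rewrite ltnS.
  rewrite size_filter ltn_neqAle count_size andbT -all_count.
  by apply/negP => /allP/(_ b bs); rewrite /far eqxx.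
have tk b' : b' \in t ->
    (mu (ball b'.1 (3 * b'.2)%R) <= k%:E * \int[mu]_(x in ball b'.1 b'.2) h x)%E.
  by rewrite mem_filter => /andP[_]; exact: sk.
have mb c r := @measurable_ball R n c r.
have cover : balls s `<=` (ball b.1 (3 * b.2) : set L) `|` balls t.
  move=> x [b' b's b'x]; have [fb'|] := boolP (far b').
    by right; exists b' => //=; rewrite mem_filter fb'.
  have r0 : 0 < b.2 by case: b'x => /lt_le_trans + _; apply; exact: bmax.
  rewrite negb_and negbK => /orP[/eqP b'b|/asboolP/eqP/set0P[y [b'y by_]]]; left.
    by move: b'x; rewrite b'b; apply: le_ball; lra.
  have := ball_triangle (ball_triangle by_ (ball_sym b'y)) b'x.
  by apply: le_ball; have := bmax _ b's; lra.
have disj : [disjoint (ball b.1 b.2 : set L) & balls t].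
  apply/disj_setPS => x [xb [b' /=]]; rewrite mem_filter => /andP[/andP[_ /asboolP]].
  by move=> e _ xb'; suff : (set0 : set Rn) x by []; rewrite -e.
apply: (@le_trans _ _ (mu ((ball b.1 (3 * b.2) : set L) `|` balls t))).
  exact: le_lebesgue_outer.
apply: (@le_trans _ _ (mu (ball b.1 (3 * b.2)%R) + mu (balls t))%E).
  exact: measureU2 (mb _ _) (measurable_balls t).
apply: (le_trans (leeD (sk _ bs) (ih t tm tk))).
have i0 (A : set L) : (0 <= \int[mu]_(x in A) h x)%E by exact: integral_ge0.
rewrite -ge0_muleDr//; apply: lee_wpmul2l => //.
rewrite -(@ge0_integral_setU _ _ _ mu _ _ (mb _ _) (measurable_balls t) h
  (measurable_funTS mh) (fun x _ => h0 x) disj).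
apply: ge0_subset_integral => //.
- by apply: measurableU => //; exact: measurable_balls.
- exact: measurable_balls.
- exact: measurable_funTS.
- move=> x [xb|[b' /=]]; first by exists b.
  by rewrite mem_filter => /andP[_ b's] xb'; exists b'.
Qed.

(** The finite bound passes to an arbitrary set [E] by continuity from below along finite unions of
    balls contained in [C]. The factors 3 and 7 leave room for moving centres and radii to rational
    values. *)
Lemma vitali_outer_bound (h : L -> \bar R) (k : R) (E C : set L) :
  0 <= k -> measurable_fun [set: L] h -> (forall x, (0 <= h x)%E) ->
  measurable C ->
  (forall x, E x -> exists2 r, 0 < r &
    (ball (x : Rn) (3 * r) : set L) `<=` C /\
    (mu (ball (x : Rn) (7 * r)%R) <= k%:E * \int[mu]_(y in ball (x : Rn) r) h y)%E) ->
  (lebesgue_outer E <= k%:E * \int[mu]_(y in C) h y)%E.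
Proof.
move=> k0 mh h0 mC EP.
have mb c r := @measurable_ball R n c r.
(* Rational balls make the cover countable, so that finite subfamilies
   exhaust it. *)
pose qc (z : 'rV[rat]_n.+1 * rat) : Rn := map_mx ratr z.1.
pose qr (z : 'rV[rat]_n.+1 * rat) : R := ratr z.2.
pose P z := (ball (qc z) (qr z) : set L) `<=` C /\
  (mu (ball (qc z) (3 * qr z)%R) <= k%:E * \int[mu]_(y in ball (qc z) (qr z)) h y)%E.
(* Indices that code no admissible ball are sent to radius 0, that is, to the empty ball. *)
pose G i : Rn * R := if unpickle i is Some z then
  if `[< P z >] then (qc z, qr z) else (0, 0) else (0, 0).
have ball00 : (ball (0 : Rn) (0 : R) : set L) = set0.
  by apply/seteqP; split => // x []; rewrite ltxx.
have GC i : (ball (G i).1 (G i).2 : set L) `<=` C.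
  rewrite /G; case: unpickle => [z|]; last by rewrite ball00.
  by case: asboolP => [[]//|_]; rewrite ball00.
have Gk i : (mu (ball (G i).1 (3 * (G i).2)%R) <=
    k%:E * \int[mu]_(y in ball (G i).1 (G i).2) h y)%E.
  have z0 : (mu (ball (0%R : Rn) (3 * (0 : R))%R) <=
      k%:E * \int[mu]_(y in ball (0%R : Rn) (0%R : R)) h y)%E.
    by rewrite mulr0 ball00 measure0 mule_ge0//; exact: integral_ge0.
  rewrite /G; case: unpickle => [z|//].
  by case: asboolP => [[]//|_].
pose V N := balls [seq G i | i <- iota 0 N].
have VE N : V N = \bigcup_(i in [set i | (i < N)%N]) (ball (G i).1 (G i).2 : set L).
  apply/seteqP; split => x.
    by move=> [_ /mapP[i + ->] xi]; rewrite mem_iota => iN; exists i.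
  by move=> [i iN xi]; exists (G i) => //=; apply: map_f; rewrite mem_iota.
have Vnd : nondecreasing_seq V.
  move=> i j ij; apply/subsetPset => x; rewrite !VE => -[k' ki xk'].
  by exists k' => //=; exact: leq_trans ij.
have Vbound N : (mu (V N) <= k%:E * \int[mu]_(y in C) h y)%E.
  apply: (@le_trans _ _ (k%:E * \int[mu]_(y in V N) h y)%E).
    apply: vitali_measure_bound => // _ /mapP[i _ ->]; exact: Gk.
  apply: lee_wpmul2l => //; apply: ge0_subset_integral => //.
  - exact: measurable_balls.
  - exact: measurable_funTS.
  - by rewrite VE => x [i _]; exact: GC.
have mV N : measurable (V N) by exact: measurable_balls.
have mVoo : measurable (\bigcup_N V N) by exact: bigcup_measurable.
apply: (@le_trans _ _ (mu (\bigcup_N V N))).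
  apply: le_lebesgue_outer => x /EP[r r0 [rC rk]].
  (* A radius between [3 / 2 * r] and [2 * r] and a centre within [r / 2] of [x] give a ball that
     contains [ball x r], lies in [ball x (3 * r)], and has its threefold enlargement in
     [ball x (7 * r)]. *)
  have [s] : exists s, ratr s \in `]3 / 2 * r, 2 * r[ by apply/rat_in_itvoo; lra.
  rewrite in_itv/= => /andP[s1 s2].
  have /(_ _)/cid - /all_sig[y yP] i :
      exists y, ratr y \in `](x : Rn) 0 i - r / 2, (x : Rn) 0 i + r / 2[.
    by apply/rat_in_itvoo; lra.
  pose z := (\row_i y i, s) : 'rV[rat]_n.+1 * rat.
  have xz : ball (x : Rn) (r / 2) (qc z).
    split=> [|j i]; first by lra.
    by rewrite ord1 !mxE; have := yP i; rewrite in_itv/= -ltr_distlC.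
  have sub1 e : r / 2 + qr z <= e -> ball (qc z) (qr z) `<=` ball (x : Rn) e.
    by move=> re w zw; apply: (le_ball _ (ball_triangle xz zw)).
  have Pz : P z; last first.
    exists (pickle z).+1 => //; rewrite VE; exists (pickle z) => //=.
    rewrite /G pickleK; case: asboolP => // _ /=.
    by apply: (le_ball _ (ball_sym xz)); rewrite /qr/=; lra.
  split; first by apply: subset_trans rC; apply: sub1; rewrite /qr/=; lra.
  apply: (@le_trans _ _ (mu (ball (x : Rn) (7 * r)%R))).
    apply: le_lebesgue_outer => w zw; apply: (le_ball _ (ball_triangle xz zw)).
    by rewrite /qr/=; lra.
  apply: (le_trans rk); apply: lee_wpmul2l; first by rewrite lee_fin.
  apply: ge0_subset_integral.
  - exact: mb.
  - exact: mb.
  - exact: measurable_funTS.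
  - by move=> w _; exact: h0.
  - move=> w xw; apply: (le_ball _ (ball_triangle (ball_sym xz) xw)).
    by rewrite /qr/=; lra.
have cvgV := @nondecreasing_cvg_mu _ _ _ mu _ mV mVoo Vnd.
rewrite -(cvg_lim _ cvgV)//; apply: lime_le.
  by apply/cvg_ex; exists (mu (\bigcup_N V N)).
by apply: nearW => N /=; exact: Vbound.
Qed.

End vitali.

(** Turns a lower bound on an average into one on the integral. The case [q = 0] is included because
    balls are not shown to have positive measure. *)
Lemma mule_le_of_lt_inve {R : realType} (c : R) (q a : \bar R) :
  (0 <= q)%E -> (q < +oo)%E -> (0 <= a)%E -> (c%:E < q^-1 * a)%E ->
  (c%:E * q <= a)%E.
Proof.
case: q => // v; rewrite lee_fin le_eqVlt => /predU1P[<- _ a0 _|v0 _ _].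
  by rewrite mule0.
by rewrite inver gt_eqF// => /ltW; rewrite lee_pdivlMl// muleC.
Qed.

Lemma measurable_cutoff d (T : measurableType d) (R : realType) (f : T -> R)
    (s : R) :
  measurable_fun [set: T] f ->
  measurable_fun [set: T] (fun x => if s < f x then f x else 0).
Proof.
move=> mf; apply: measurable_fun_ifT; [|exact: mf|exact: measurable_cst].
by apply: measurable_fun_ltr; [exact: measurable_cst|exact: mf].
Qed.

Section weak_type.
Context {R : realType} {n m : nat}.
Notation Rn := 'rV[R]_n.+1.
Notation L := (lebesgue_space R n).
Local Notation mu := (@lebesgue_Rn R n : {measure set L -> \bar R}).
Local Notation kappa := ((n.+2%:R * 7) ^+ n.+1 : R).
Local Notation cube M := (box (const_mx (- M%:R), const_mx M%:R) : set L).
Variable g : Rn -> 'rV[R]_m.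
Hypotheses (gper : Zn_periodic g) (mg : vmeasurable setT g).

Let h : L -> R := fun x => enorm (g x).
Let ht (s : R) : L -> R := fun x => if s < h x then h x else 0.

Let h0 x : 0 <= h x. Proof. exact: sqrtr_ge0. Qed.

Let ht0 s x : 0 <= ht s x. Proof. by rewrite /ht; case: ifP. Qed.

Let mh : measurable_fun [set: L] h. Proof. exact: measurable_enorm. Qed.

Let mht s : measurable_fun [set: L] (ht s).
Proof.
exact: measurable_cutoff.
Qed.

Let hper : Zn_periodic (fun x : Rn => (h x)%:E).
Proof. by move=> x z; rewrite /h gper. Qed.

Let htper s : Zn_periodic (fun x : Rn => (ht s x)%:E).
Proof. by move=> x z; rewrite /ht /h gper. Qed.

(* [ball] is the ball of the supremum norm, [eball] the Euclidean one. *)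
Let mball (x : Rn) r := @measurable_ball R n x r.
Let meball (x : Rn) r := @measurable_eball R n x r.

Let ball_eball (x : Rn) r :
  (mu (ball x (7 * r)%R) <= kappa%:E * mu (eball x r))%E.
Proof.
apply: le_trans (lebesgue_eball_scale x r _); last by rewrite mulr_gt0.
by apply: le_lebesgue_outer; rewrite -mulrA; exact: ball_sub_eball.
Qed.

Let eball_fin (x : Rn) r : 0 < r -> (mu (eball x r) < +oo)%E.
Proof.
move=> r0; apply: le_lt_trans (lebesgue_Rn_ball x r).
by apply: le_lebesgue_outer; exact: eball_sub_ball.
Qed.

(** The supremum need not be attained; halving [s] makes the inequality strict and so produces a
    radius. *)
Lemma maximal_ge_average (x : Rn) (s : R) : 0 < s -> (s%:E <= maximal g x)%E ->
  exists2 r, 0 < r &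
    ((s / 2)%:E * mu (eball x r) <= \int[mu]_(y in eball x r) (h y)%:E)%E.
Proof.
move=> s0 sM; have : ((s / 2)%:E < maximal g x)%E.
  by apply: lt_le_trans sM; rewrite lte_fin; lra.
case/ereal_sup_gt => y [r /=]; rewrite in_itv/= andbT => r0 <-{y} lt; exists r => //.
apply: mule_le_of_lt_inve lt.
- exact: (measure_ge0 mu).
- exact: eball_fin.
- by apply: integral_ge0 => y' _; rewrite lee_fin h0.
Qed.

(** Since [h <= ht (s / 4) + s / 4], values of [h] up to [s / 4] account for at most half of the
    average. *)
Lemma average_small_truncation (x : Rn) (r s : R) : 0 < r -> 0 < s ->
  ((s / 2)%:E * mu (eball x r) <= \int[mu]_(y in eball x r) (h y)%:E)%E ->
  ((s / 4)%:E * mu (eball x r) <= \int[mu]_(y in eball x r) (ht (s / 4) y)%:E)%E.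
Proof.
move=> r0 s0; set e := (eball x r : set L) => avg.
have mht4 : measurable_fun e (fun y => (ht (s / 4) y)%:E).
  by apply/measurable_EFinP; exact: measurable_funTS.
have : ((s / 2)%:E * mu e <=
    \int[mu]_(y in e) (ht (s / 4) y)%:E + (s / 4)%:E * mu e)%E.
  apply: (le_trans avg).
  rewrite -(integral_cst mu (meball x r) (s / 4)%:E) -ge0_integralD//; first last.
  - by move=> y _; rewrite lee_fin; lra.
  - by move=> y _; rewrite lee_fin.
  - exact: meball.
  apply: ge0_le_integral.
  - exact: meball.
  - by move=> y _; rewrite lee_fin.
  - by apply/measurable_EFinP; exact: measurable_funTS.
  - by apply: emeasurable_funD => //; exact: measurable_cst.
  - move=> y _; rewrite -EFinD lee_fin /ht; case: ltP => hy; last by rewrite add0r.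
    by rewrite lerDl; lra.
have : (0 <= \int[mu]_(y in e) (ht (s / 4) y)%:E)%E.
  by apply: integral_ge0 => y _; rewrite lee_fin.
have : mu e \is a fin_num by rewrite ge0_fin_numE ?measure_ge0// eball_fin.
move: (mu e) (\int[mu]_(y in e) _)%E => [v| |]// [a| |]// a0 _; rewrite ?leey//.
by rewrite -!EFinM -EFinD !lee_fin; lra.
Qed.

(** A ball of radius at least 1 is comparable to a cube made of whole cells; by periodicity its
    average is controlled by the average over one cell. *)
Lemma average_large_radius (x : Rn) (r s : R) : cell x -> 1 <= r -> 0 < s ->
  ((s / 2)%:E * mu (eball x r) <= \int[mu]_(y in eball x r) (h y)%:E)%E ->
  ((s / 2)%:E * mu (cell : set L) <= kappa%:E * \int[mu]_(y in cell) (h y)%:E)%E.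
Proof.
move=> xC r1 s0 avg; have r0 : 0 < r by lra.
(* For [x] in the cell, [r + 1 < M] puts [eball x r] inside [cube M], while [M <= r + 2] and
   [1 <= r] put [cube M] inside [ball x (7 * r)]. *)
pose M := (Num.truncn r).+2; have Mr : r + 1 < M%:R <= r + 2.
  have /andP[h1 h2] := truncn_itv (ltW r0).
  by move: h2; rewrite /M -addn2 natrD -natr1; lra.
have mhE : measurable_fun [set: L] (fun y => (h y)%:E) by exact/measurable_EFinP.
have hE0 y : (0 <= (h y)%:E)%E by rewrite lee_fin.
have k0 : 0 <= kappa by rewrite exprn_ge0// mulr_ge0.
have s20 : 0 <= s / 2 by lra.
have N0 : 0 < (((2 * M) ^ n.+1)%N%:R : R) by rewrite ltr0n expn_gt0.
rewrite -(@lee_pmul2l _ (((2 * M) ^ n.+1)%N%:R : R)%:E)//.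
rewrite muleCA [leRHS]muleCA -integral_cube_periodic//.
have := @integral_cube_periodic R n (cst 1%E) M (measurable_cst _)
  (fun=> lee01) (fun _ _ => erefl).
rewrite !integral_cst ?mul1e; [|exact: measurable_cell|exact: measurable_box].
move=> <-//.
apply: (@le_trans _ _ ((s / 2)%:E * (kappa%:E * mu (eball x r)))%E).
  apply: lee_wpmul2l; first by rewrite lee_fin.
  apply: le_trans (ball_eball x r); apply: le_lebesgue_outer => y yM.
  split=> [|j i]; first by lra.
  rewrite ord1 /ball/= ltr_distl.
  by have := yM i; have := xC i; rewrite /= !mxE; lra.
rewrite muleCA; apply: lee_wpmul2l; first by rewrite lee_fin.
apply: (le_trans avg); apply: ge0_subset_integral.
- exact: meball.
- exact: measurable_box.
- exact: measurable_funTS.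
- by move=> y _; exact: hE0.
- move=> y /(eball_sub_ball r0)[_ xy] i; rewrite /= !mxE.
  have := xy 0 i; have := xC i; rewrite /ball/= ltr_distl !mxE; lra.
Qed.

(* The lower bound on [s] rules out balls of radius at least 1, whose averages
   are controlled by the average over a cell. *)
Lemma maximal_weak_type (s : R) : 0 < s ->
  (kappa%:E * \int[mu]_(y in cell) (h y)%:E < (s / 2)%:E * mu (cell : set L))%E ->
  (torus_measure [set x : Rn | s%:E <= maximal g x] <=
   (kappa * (4 / s) * (8 ^ n.+1)%:R)%:E *
   \int[mu]_(y in cell) (ht (s / 4) y)%:E)%E.
Proof.
move=> s0 s_large.
have k0 : 0 <= kappa by rewrite exprn_ge0// mulr_ge0.
have mhtE : measurable_fun [set: L] (fun y => (ht (s / 4) y)%:E).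
  by exact/measurable_EFinP.
(* The factor [8 ^ n.+1] counts the cells of [cube 4], which contains [ball x (3 * r)] for [x] in
   the cell and [r < 1]. *)
rewrite EFinM -muleA -(@integral_cube_periodic _ _ _ 4)//; last first.
  by move=> y; rewrite lee_fin.
(* By definition [torus_measure] is the outer measure of the part in the cell, so the bound applies
   directly to the superlevel set. *)
apply: vitali_outer_bound => //.
- by rewrite mulr_ge0// divr_ge0// ltW.
- by move=> y; rewrite lee_fin.
- exact: measurable_box.
move=> x [sM xC].
have [r r0 avg] := maximal_ge_average s0 sM.
have r1 : r < 1.
  rewrite ltNge; apply/negP => r1; have := average_large_radius xC r1 s0 avg.
  by rewrite leNgt s_large.
exists r => //; split.
  move=> y [_ xy] i; rewrite /= !mxE.
  have := xy 0 i; have := xC i; rewrite /ball/= ltr_distl !mxE; lra.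
apply: (le_trans (ball_eball x r)).
rewrite EFinM -muleA; apply: lee_wpmul2l; first by rewrite lee_fin.
rewrite -[4 / s]invf_div lee_pdivlMl ?divr_gt0//.
apply: le_trans (average_small_truncation r0 s0 avg) _.
apply: ge0_subset_integral.
- exact: meball.
- exact: mball.
- exact: measurable_funTS.
- by move=> y _; rewrite lee_fin.
- exact: eball_sub_ball.
Qed.

End weak_type.

(** * A Gehring-type lemma *)

Section gehring_scalars.
Context {R : realType}.
Variables (p C b lam0 q : R) (d : nat).
Hypotheses (p1 : 1 < p) (C0 : 0 < C) (b0 : 0 < b) (lam00 : 0 < lam0).
Hypotheses (q1 : 1 <= q) (q2 : q <= 2).

Let q0 : 0 <= q. Proof. exact: le_trans q1. Qed.

Let p10 : 0 < p - 1. Proof. by rewrite subr_gt0. Qed.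

Local Notation lam j := (lam0 * 2 ^+ j).
Local Notation kappa := (2 `^ (p - 1) / (2 `^ (p - 1) - 1)).

(** The dyadic levels whose [C]-multiple lies below [t], weighted by [q ^+ j]. With [q = 2]^
    eps[, the quantity](q - 1) * upper_levels N t + 1[stands for a multiple of]t [^ eps]. *)
Definition upper_levels (N : nat) (t : R) : R :=
  \sum_(j < N) q ^+ j * (C * lam j < t)%R%:R.

Definition lower_levels (N : nat) (t : R) : R :=
  \sum_(j < N) q ^+ j * lam j `^ (p - 1) * (b * lam j < t)%R%:R.

Lemma upper_levels_ge0 N t : 0 <= upper_levels N t.
Proof. by apply: sumr_ge0 => j _; rewrite mulr_ge0// exprn_ge0. Qed.

Lemma upper_levelsS N t : upper_levels N t <= upper_levels N.+1 t.
Proof.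
by rewrite /upper_levels big_ord_recr/= lerDl mulr_ge0// exprn_ge0.
Qed.

Lemma upper_levels_homo t : {homo upper_levels ^~ t : M N / (M <= N)%N >-> M <= N}.
Proof.
move=> M N MN; rewrite -(subnKC MN).
by elim: (N - M)%N => [|k ih]; rewrite ?addn0// addnS (le_trans ih)// upper_levelsS.
Qed.

(** A geometric sum, cleared of its denominator so that [q = 1] is covered. *)
Lemma upper_levels_full N t : (forall j, (j < N)%N -> C * lam j < t) ->
  (q - 1) * upper_levels N t + 1 = q ^+ N.
Proof.
elim: N => [|N ih] full.
  by rewrite /upper_levels big_ord0 mulr0 add0r expr0.
rewrite /upper_levels big_ord_recr/= full// mulr1 mulrDr.
have := ih (fun j jN => full j (ltnW jN)); rewrite /upper_levels => <-.
set S := \sum_(_ < _) _; rewrite exprS.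
have := ih (fun j jN => full j (ltnW jN)); rewrite /upper_levels -/S => <-; ring.
Qed.

Let rho1 : 1 < 2 `^ (p - 1) :> R.
Proof.
have := @gt0_ltr_powR _ _ p10 1 2; rewrite powR1 !nnegrE; apply => //.
by rewrite ltr1n.
Qed.

Let lam_gt0 j : 0 < lam j. Proof. by rewrite mulr_gt0// exprn_gt0. Qed.

Lemma sum_lam_powR N :
  \sum_(j < N.+1) lam j `^ (p - 1) <= kappa * lam N `^ (p - 1).
Proof.
have k1 : 1 <= kappa.
  by have := rho1; move: (_ `^ _) => r r1; rewrite ler_pdivlMr; lra.
elim: N => [|N ih]; first by rewrite big_ord1 ler_peMl ?powR_ge0.
rewrite big_ord_recr/= (le_trans (lerD ih (lexx _)))//.
have -> : lam N.+1 `^ (p - 1) = 2 `^ (p - 1) * lam N `^ (p - 1).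
  by rewrite -powRM ?(ltW (lam_gt0 _))// exprS mulrCA.
have := rho1; move: (2 `^ _) (lam N `^ _) => r a r1.
rewrite le_eqVlt; apply/orP; left; apply/eqP; field.
by rewrite subr_eq0 gt_eqF.
Qed.

Lemma lower_levels_le N t : C <= b * 2 ^+ d -> 0 <= t ->
  lower_levels N t <=
  kappa * (t / b) `^ (p - 1) * 2 ^+ d * ((q - 1) * upper_levels N t + 1).
Proof.
have q10 : 0 <= q - 1 by rewrite subr_ge0.
have k0 : 0 <= kappa by have := rho1; move: (_ `^ _) => r r1; rewrite divr_ge0; lra.
have S0 M : 1 <= (q - 1) * upper_levels M t + 1.
  by rewrite lerDr mulr_ge0 ?upper_levels_ge0.
move=> Cbd t0; elim: N => [|N ih].
  rewrite /lower_levels big_ord0; apply: mulr_ge0 (le_trans ler01 (S0 _)).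
  by rewrite mulr_ge0 ?exprn_ge0// mulr_ge0 ?powR_ge0.
have [bt|bt] := boolP (b * lam N < t); last first.
  rewrite /lower_levels big_ord_recr/= (negbTE bt) mulr0 addr0 (le_trans ih)//.
  rewrite ler_wpM2l//; first by rewrite mulr_ge0 ?exprn_ge0// mulr_ge0 ?powR_ge0.
  by rewrite lerD2r ler_wpM2l ?upper_levelsS.
have qN : q ^+ N <= 2 ^+ d * ((q - 1) * upper_levels N.+1 t + 1).
  have qd : q ^+ d <= 2 ^+ d by rewrite lerXn2r// nnegrE.
  (* For [N <= d] the summand 1 suffices; otherwise [q ^+ (N - d)] is a full geometric sum, since
     all levels below [N - d] satisfy [C * lam j < t]. *)
  have [Nd|dN] := leqP N d.
    apply: (@le_trans _ _ (2 ^+ d)); last by rewrite ler_peMr ?exprn_ge0.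
    by rewrite (le_trans _ qd)// ler_weXn2l.
  rewrite -(subnKC (ltnW dN)) exprD ler_pM ?exprn_ge0//.
  rewrite -(@upper_levels_full _ t) => [|j jN]; last first.
    apply: le_lt_trans bt; apply: (@le_trans _ _ (b * 2 ^+ d * lam j)).
      by rewrite ler_wpM2r// ltW.
    rewrite -mulrA ler_wpM2l ?(ltW b0)// mulrCA ler_wpM2l ?(ltW lam00)//.
    by rewrite -exprD ler_weXn2l ?ler1n// -(subnKC (ltnW dN)) leq_add2l ltnW.
  rewrite lerD2r ler_wpM2l//.
  by apply: upper_levels_homo; rewrite leqW// leq_addl.
apply: (@le_trans _ _ (\sum_(j < N.+1) q ^+ N * lam j `^ (p - 1))).
  apply: ler_sum => j _; apply: (@le_trans _ _ (q ^+ j * lam j `^ (p - 1))).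
    by rewrite ler_piMr ?lern1 ?leq_b1// mulr_ge0 ?powR_ge0 ?exprn_ge0.
  by rewrite ler_wpM2r ?powR_ge0// ler_weXn2l// -ltnS.
rewrite -mulr_sumr mulrC -mulrA ler_pM ?sumr_ge0 ?exprn_ge0//.
  by move=> j _; exact: powR_ge0.
apply: le_trans (sum_lam_powR N) _; rewrite ler_wpM2l// ge0_ler_powR ?nnegrE//.
- by rewrite ltW.
- by rewrite ltW.
- by rewrite divr_ge0// ltW.
- by rewrite ler_pdivlMr// mulrC ltW.
Qed.

Lemma powR_le_upper_levels (eps t : R) : q = 2 `^ eps -> 0 <= t -> 0 <= eps ->
  exists N, t `^ eps <= (C * lam0) `^ eps * ((q - 1) * upper_levels N t + 1).
Proof.
move=> qE t0 eps0.
have Cl0 : 0 < C * lam0 by rewrite mulr_gt0.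
have exN : exists N, ~~ (C * lam N < t).
  exists (Num.truncn (t / (C * lam0))).+1; rewrite -leNgt mulrA -ler_pdivrMl//.
  rewrite mulrC; have /andP[_ /ltW h] := truncn_itv (divr_ge0 t0 (ltW Cl0)).
  by apply: (le_trans h); rewrite -natrX ler_nat ltnW// ltn_expl.
exists (ex_minn exN); case: ex_minnP => N; rewrite -leNgt => tN minN.
rewrite upper_levels_full => [|j jN]; last first.
  by rewrite ltNge; apply/negP => /=; rewrite leNgt => /minN; rewrite leqNgt jN.
rewrite qE -powR_mulrn ?powR_ge0// powRAC powR_mulrn//.
rewrite -powRM ?(ltW Cl0) ?exprn_ge0//.
by rewrite ge0_ler_powR ?nnegrE ?mulr_ge0 ?exprn_ge0 ?(ltW C0) ?(ltW lam00)// -mulrA.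
Qed.

End gehring_scalars.

Section gehring.
Context d (T : measurableType d) (R : realType) (mu : {measure set T -> \bar R}).
Variable h : T -> R.
Hypotheses (mh : measurable_fun [set: T] h) (h0 : forall x, 0 <= h x).

Let mlt (c : R) : measurable_fun [set: T] (fun x => (c < h x)%R%:R : R).
Proof.
under eq_fun do rewrite mulrb.
apply: measurable_fun_ifT; [|exact: measurable_cst|exact: measurable_cst].
by apply: measurable_fun_ltr; [exact: measurable_cst|exact: mh].
Qed.

Let mpow (r : R) : measurable_fun [set: T] (fun x => h x `^ r).
Proof. exact: (measurableT_comp (measurable_powR r)). Qed.

Let msum (a c : nat -> R) N :
  measurable_fun [set: T] (fun x => \sum_(j < N) a j * (c j < h x)%R%:R).
Proof.
apply: measurable_sum => j; apply: measurable_funM; first exact: measurable_cst.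
exact: mlt.
Qed.

Lemma integral_levels (g : T -> R) (a c : nat -> R) N :
  measurable_fun [set: T] g -> (forall x, 0 <= g x) -> (forall j, 0 <= a j) ->
  (\int[mu]_x (g x * \sum_(j < N) a j * (c j < h x)%R%:R)%:E =
   \sum_(j < N) (a j)%:E * \int[mu]_x (g x * (c j < h x)%R%:R)%:E)%E.
Proof.
move=> mg g0 a0.
have e0 j x : (0 <= (g x * (c j < h x)%R%:R)%:E)%E by rewrite lee_fin mulr_ge0.
have me j : measurable_fun [set: T] (fun x => (g x * (c j < h x)%R%:R)%:E).
  by apply/measurable_EFinP; apply: measurable_funM; [exact: mg|exact: mlt].
transitivity (\int[mu]_x
    \sum_(j < N) ((a j)%:E * (g x * (c j < h x)%R%:R)%:E))%E.
  apply: eq_integral => x _; rewrite mulr_sumr -sumEFin.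
  by apply: eq_bigr => j _; rewrite -EFinM mulrCA.
rewrite ge0_integral_sum//.
- by apply: eq_bigr => j _; rewrite ge0_integralZl_EFin.
- by move=> j; apply: measurable_funeM; exact: me.
- by move=> j x _; rewrite mule_ge0// lee_fin.
Qed.

(* Multiply the hypothesis at [lam0 * 2 ^ j] by [(2 `^ eps) ^ j] and sum over
   [j < N]: as [2 `^ eps - 1] is small, the right-hand side is absorbed in the
   left-hand side, uniformly in [N]. *)
Theorem gehring_integrability (p C b K lam0 eps : R) (e : nat) :
  1 < p -> 0 < C -> 0 < b -> 0 <= K -> 0 < lam0 -> C <= b * 2 ^+ e ->
  0 <= eps -> 2 `^ eps <= 2 ->
  K * (2 `^ (p - 1) / (2 `^ (p - 1) - 1) * b^-1 `^ (p - 1) * 2 ^+ e) *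
    (2 `^ eps - 1) <= 2^-1 ->
  (\int[mu]_x (h x `^ p)%:E < +oo)%E ->
  (forall lam, lam0 <= lam ->
    (\int[mu]_x (h x `^ p * (C * lam < h x)%R%:R)%:E <=
     (K * lam `^ (p - 1))%:E * \int[mu]_x (h x * (b * lam < h x)%R%:R)%:E)%E) ->
  (\int[mu]_x (h x `^ (p + eps))%:E < +oo)%E.
Proof.
move=> p1 C0 b0 K0 lam00 Cbe eps0; set q := 2 `^ eps => q2.
set Mc := (_ * _ * 2 ^+ e) => small hp_fin level.
have q1 : 1 <= q by rewrite /q -[leLHS](powRr0 2) ler_powR ?ler1n.
have q0 : 0 <= q by exact: le_trans q1.
have p0 : 0 < p by lra.
have p10 : 0 < p - 1 by lra.
have Mc0 : 0 <= Mc.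
  rewrite /Mc mulr_ge0 ?exprn_ge0// mulr_ge0 ?powR_ge0// divr_ge0 ?powR_ge0//.
  by rewrite subr_ge0 -[leLHS](powRr0 2) ler_powR ?ler1n// ltW.
pose U N x := upper_levels C lam0 q N (h x).
have U0 N x : 0 <= U N x by exact: upper_levels_ge0.
pose lam j : R := lam0 * 2 ^+ j.
have mU N : measurable_fun [set: T] (U N).
  exact: (msum (fun j => q ^+ j) (fun j => C * lam j)).
pose hp x := h x `^ p.
have hp0 x : 0 <= hp x by exact: powR_ge0.
have mhp : measurable_fun [set: T] hp by exact: mpow.
pose J N := (\int[mu]_x (hp x * U N x)%:E)%E.
pose P := (\int[mu]_x (hp x)%:E)%E.
have mJ N : measurable_fun [set: T] (fun x => (hp x * U N x)%:E).
  by apply/measurable_EFinP; apply: measurable_funM; [exact: mhp|exact: mU].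
have P_fin : P \is a fin_num.
  by rewrite ge0_fin_numE//; apply: integral_ge0 => x _; rewrite lee_fin.
have J_ge0 N : (0 <= J N)%E.
  by apply: integral_ge0 => x _; rewrite lee_fin mulr_ge0.
(* Finiteness comes from stopping at level [N]; it is needed to subtract [J N] when absorbing. *)
have J_fin N : J N \is a fin_num.
  rewrite ge0_fin_numE//.
  apply: (@le_lt_trans _ _ ((\sum_(j < N) q ^+ j)%:E * P)%E); last first.
    by rewrite -(fineK P_fin) -EFinM ltry.
  have s0 : 0 <= \sum_(j < N) q ^+ j by apply: sumr_ge0 => j _; rewrite exprn_ge0.
  rewrite -ge0_integralZl_EFin//; first last.
  - exact/measurable_EFinP.
  - by move=> x _; rewrite lee_fin.
  apply: ge0_le_integral => //.
  - by move=> x _; rewrite lee_fin mulr_ge0.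
  - by apply: measurable_funeM; exact/measurable_EFinP.
  - move=> x _; rewrite -EFinM lee_fin mulrC ler_wpM2r//.
    apply: ler_sum => j _; rewrite ler_piMr ?exprn_ge0//.
    by rewrite lern1 leq_b1.
(* [F N] serves twice: [Mc * F N] bounds [h] times the lower level sum, and at each point [h]^ (p +
   eps)[is at most](C * lam0) [^ eps * F N] for some [N]. *)
pose F N x := hp x * ((q - 1) * U N x + 1).
have F0 N x : 0 <= F N x.
  by rewrite mulr_ge0// addr_ge0// mulr_ge0// subr_ge0.
have mF N : measurable_fun [set: T] (fun x => (F N x)%:E).
  apply/measurable_EFinP; apply: measurable_funM; first exact: mhp.
  apply: measurable_funD; last exact: measurable_cst.
  by apply: measurable_funM; [exact: measurable_cst|exact: mU].
have intF N : (\int[mu]_x (F N x)%:E = (q - 1)%:E * J N + P)%E.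
  rewrite -ge0_integralZl_EFin//; last 2 first.
  - by move=> x _; rewrite lee_fin mulr_ge0.
  - by rewrite subr_ge0.
  rewrite -ge0_integralD//; last 4 first.
  - by move=> x _; rewrite mule_ge0// lee_fin ?subr_ge0// mulr_ge0.
  - exact: measurable_funeM.
  - by move=> x _; rewrite lee_fin.
  - exact/measurable_EFinP.
  apply: eq_integral => x _; rewrite -EFinM -EFinD; congr EFin.
  by rewrite /F mulrDr mulr1 mulrCA.
have J_le N : (J N <= (K * Mc)%:E * ((q - 1)%:E * J N + P))%E.
  rewrite {1}/J /U /upper_levels.
  rewrite (integral_levels (fun j => C * lam j) N mhp hp0 (fun j => exprn_ge0 j q0)).
  apply: (@le_trans _ _ (\int[mu]_x
      (h x * \sum_(j < N) K * (q ^+ j * lam j `^ (p - 1)) * (b * lam j < h x)%R%:R)%:E)%E).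
    rewrite (@integral_levels h (fun j => K * (q ^+ j * lam j `^ (p - 1)))
      (fun j => b * lam j))//; last first.
      by move=> j; rewrite mulr_ge0// mulr_ge0 ?exprn_ge0 ?powR_ge0.
    apply: lee_sum => j _.
    rewrite [K * (q ^+ j * _)]mulrCA [(q ^+ j * _)%:E]EFinM -muleA.
    apply: lee_wpmul2l; first by rewrite lee_fin exprn_ge0.
    by apply: level; rewrite ler_peMr ?(ltW lam00)// exprn_ege1// ler1n.
  rewrite -intF -ge0_integralZl_EFin//; last 2 first.
  - by move=> x _; rewrite lee_fin.
  - by rewrite mulr_ge0.
  have lowE N' x : \sum_(j < N') K * (q ^+ j * lam j `^ (p - 1)) * (b * lam j < h x)%R%:R =
      K * lower_levels p b lam0 q N' (h x).
    by rewrite /lower_levels mulr_sumr; apply: eq_bigr => j _; rewrite -!mulrA.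
  apply: ge0_le_integral => //.
  - move=> x _; rewrite lee_fin mulr_ge0// lowE mulr_ge0//.
    by apply: sumr_ge0 => j _; rewrite mulr_ge0// mulr_ge0 ?exprn_ge0 ?powR_ge0.
  - apply/measurable_EFinP; apply: measurable_funM; first exact: mh.
    exact: (msum (fun j => K * (q ^+ j * lam j `^ (p - 1))) (fun j => b * lam j)).
  - exact: measurable_funeM.
  - move=> x _; rewrite -EFinM lee_fin lowE mulrCA -[leRHS]mulrA ler_wpM2l//.
    have := @lower_levels_le _ p C b lam0 q e p1 b0 lam00 q1 q2 N _ Cbe (h0 x).
    move=> /(ler_wpM2l (h0 x)) /le_trans; apply.
    rewrite powRM ?invr_ge0 ?(ltW b0)// /F /hp -(mulr_powRB1 (h0 x) p0) /Mc /U.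
    by rewrite le_eqVlt; apply/orP; left; apply/eqP; ring.
(* From [J <= K * Mc * ((q - 1) * J + P)] and [K * Mc * (q - 1) <= 1 / 2] follows
   [J <= 2 * (K * Mc) * P], uniformly in [N]. *)
pose B := (q - 1) * (2 * (K * Mc) * fine P) + fine P.
have F_le N : (\int[mu]_x (F N x)%:E <= B%:E)%E.
  rewrite intF; have := J_le N; have := J_ge0 N.
  rewrite -(fineK (J_fin N)) -(fineK P_fin) -!(EFinM, EFinD) !lee_fin.
  move: (fine (J N)) => j; rewrite /B; move: (fine P) => P' j0 jle.
  rewrite lerD2r ler_wpM2l ?subr_ge0//.
  have : K * Mc * (q - 1) * j <= 2^-1 * j by rewrite ler_wpM2r.
  move: jle; move: (K * Mc) (q - 1) => k r jle hs.
  have : k * (r * j + P') = k * r * j + k * P' by ring.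
  have : 2 * k * P' = 2 * (k * P') by ring.
  by move: (k * r * j) (k * P') jle hs => a a'; lra.
have ndF x : {homo (fun N => (F N x)%:E) : M N / (M <= N)%N >-> (M <= N)%E}.
  move=> M N MN; rewrite lee_fin ler_wpM2l// lerD2r ler_wpM2l ?subr_ge0//.
  exact: upper_levels_homo.
have cvgF x : cvgn (fun N => (F N x)%:E) by exact: ereal_nondecreasing_is_cvgn (ndF x).
have limF_ge N x : ((F N x)%:E <= limn (fun N => (F N x)%:E))%E.
  by apply: lime_ge => //; exists N => // M /= NM; exact: ndF.
have mlim : measurable_fun [set: T] (fun x => limn (fun N => (F N x)%:E)).
  by apply: (emeasurable_fun_cvg (fun N x => (F N x)%:E)) => // x _; exact: cvgF.
(* The index [N] depends on the point, so [F N] is replaced by its increasing limit and monotone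
   convergence is applied. *)
apply: (@le_lt_trans _ _ (((C * lam0) `^ eps)%:E *
    \int[mu]_x limn (fun N => (F N x)%:E))%E).
  rewrite -ge0_integralZl_EFin//; last 2 first.
  - by move=> x _; apply: le_trans (limF_ge 0%N x); rewrite lee_fin.
  - exact: powR_ge0.
  apply: ge0_le_integral => //.
  - by move=> x _; rewrite lee_fin powR_ge0.
  - by apply/measurable_EFinP; exact: mpow.
  - exact: measurable_funeM.
  - move=> x _.
    have [N hN] := @powR_le_upper_levels _ C lam0 q C0 lam00 eps (h x)
      erefl (h0 x) eps0.
    apply: (@le_trans _ _ (((C * lam0) `^ eps)%:E * (F N x)%:E)%E); last first.
      by apply: lee_wpmul2l; [rewrite lee_fin powR_ge0|exact: limF_ge].
    rewrite -EFinM lee_fin powRD; last by apply/implyP => /eqP; lra.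
    by rewrite /F mulrCA; apply: ler_wpM2l; [exact: hp0|exact: hN].
have FE0 N x : [set: T] x -> (0 <= (F N x)%:E)%E by rewrite lee_fin.
rewrite (@monotone_convergence _ _ _ mu _ measurableT (fun N x => (F N x)%:E)
  mF FE0 (fun x _ => ndF x)).
have lim_le : (limn (fun N => \int[mu]_x (F N x)%:E) <= B%:E)%E.
  apply: lime_le; last by apply: nearW => N; exact: F_le.
  apply: ereal_nondecreasing_is_cvgn => M N MN; apply: ge0_le_integral => //.
  - by move=> x _; rewrite lee_fin.
  - by move=> x _; exact: ndF.
apply: (@le_lt_trans _ _ (((C * lam0) `^ eps)%:E * B%:E)%E); last first.
  by rewrite -EFinM ltry.
by apply: lee_wpmul2l => //; rewrite lee_fin powR_ge0.
Qed.

End gehring.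

(** * Truncation of minimisers *)

Section A_free_operations.
Context {R : realType} {n m l k : nat}.
Notation Rn := 'rV[R]_n.+1.
Variable A : multi_index n k -> 'M[R]_(m, l).

Lemma partials_eq0 (s : seq 'I_n.+1) (g : Rn -> R) (U : set Rn) : open U ->
  (forall x, U x -> g x = 0) -> forall x, U x -> partials s g x = 0.
Proof.
move=> oU g0; elim: s => [|i s ih] //= x Ux; rewrite -/(partials s g).
rewrite -(@derive_cst R Rn R 0 x (delta_mx 0 i)).
apply: near_eq_derive; have : nbhs x U by exact: open_nbhs_nbhs.
by apply: filterS => y Uy; rewrite ih.
Qed.

Lemma adjoint_op_eq0 (phi : Rn -> 'rV[R]_l) (x : Rn) :
  ~ closure [set x | phi x <> 0] x -> adjoint_op A phi x = 0.
Proof.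
move=> xphi; rewrite /adjoint_op big1// => alpha _.
rewrite [X in X *m _](_ : _ = 0) ?mul0mx//; apply/rowP => j; rewrite !mxE.
apply: (@partials_eq0 _ _ (~` closure [set x | phi x <> 0])) => //.
  by apply: closed_openC; exact: closed_closure.
move=> y yphi; rewrite (_ : phi y = 0) ?mxE//; apply: contrapT => phiy.
exact/yphi/subset_closure.
Qed.

Lemma dotpr0 d (v : 'rV[R]_d) : dotp v 0 = 0.
Proof. by rewrite /dotp big1// => i _; rewrite mxE mulr0. Qed.

Lemma dotp0r d (v : 'rV[R]_d) : dotp 0 v = 0.
Proof. by rewrite /dotp big1// => i _; rewrite mxE mul0r. Qed.

(** A test function on [Omega] is one on the torus, and [adjoint_op] of it vanishes off its support
    by locality of derivatives, so both integrals agree. *)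
Lemma A_free_restrict (Omega : set Rn) (u : Rn -> 'rV[R]_m) :
  A_free A setT u -> A_free A Omega u.
Proof.
move=> Au phi [phi_per phi_smooth phi_supp].
have phiT : test_function setT phi by split.
rewrite -[RHS](Au phi phiT) integral_mkcond; apply: eq_integral => x _.
rewrite patchE; case: ifPn => // /negP xOmega.
rewrite adjoint_op_eq0 ?dotpr0// => /phi_supp xO; apply: xOmega.
by rewrite inE.
Qed.

Lemma A_free0 (Omega : set Rn) : A_free A Omega (fun=> 0).
Proof. by move=> phi _; apply: integral0_eq => x _; rewrite dotp0r. Qed.

End A_free_operations.

Lemma level_energy_bound d (T : measurableType d) (R : realType)
    (mu : {measure set T -> \bar R}) (Omega H : set T) (h Fu Ft : T -> R)
    (p M B : R) :
  measurable Omega -> measurable H -> H `<=` Omega ->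
  measurable_fun Omega h -> measurable_fun Omega Fu -> measurable_fun Omega Ft ->
  (forall x, 0 <= Fu x) -> (forall x, 0 <= Ft x) -> 0 <= B ->
  {ae mu, forall x, Omega x -> h x `^ p <= Fu x} ->
  {ae mu, forall x, Omega x -> Ft x <= B} ->
  {ae mu, forall x, Omega x -> M < h x -> H x} ->
  (forall x, Omega x -> ~ H x -> Fu x = Ft x) ->
  (\int[mu]_(x in Omega) (Fu x)%:E < +oo)%E ->
  (\int[mu]_(x in Omega) (Fu x)%:E <= \int[mu]_(x in Omega) (Ft x)%:E)%E ->
  (\int[mu]_(x in Omega) (h x `^ p * (M < h x)%R%:R)%:E <= B%:E * mu H)%E.
Proof.
move=> mO mH HO mh mFu mFt Fu0 Ft0 B0 h_le Ft_le hM_H FuFt Fu_fin Fu_le.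
have mD := measurableD mO mH.
have DO : Omega `\` H `<=` Omega by move=> x [].
have mE (F : T -> R) D : measurable D -> D `<=` Omega -> measurable_fun Omega F ->
    measurable_fun D (fun x => (F x)%:E).
  by move=> mD' DO' mF; apply/measurable_EFinP; exact: measurable_funS mF.
have split_int (F : T -> R) : measurable_fun Omega F -> (forall x, 0 <= F x) ->
    (\int[mu]_(x in Omega) (F x)%:E =
     \int[mu]_(x in H) (F x)%:E + \int[mu]_(x in Omega `\` H) (F x)%:E)%E.
  move=> mF F0; rewrite -[in LHS](setDUK HO) ge0_integral_setU//.
  - by rewrite setDUK//; exact/measurable_EFinP.
  - by move=> x _; rewrite lee_fin.
  - by apply/disj_setPS => x [Hx []].
have FuFtD : (\int[mu]_(x in Omega `\` H) (Fu x)%:E =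
              \int[mu]_(x in Omega `\` H) (Ft x)%:E)%E.
  by apply: eq_integral => x; rewrite inE => -[Ox Hx]; rewrite FuFt.
have D_fin : (\int[mu]_(x in Omega `\` H) (Ft x)%:E)%E \is a fin_num.
  rewrite ge0_fin_numE; last by apply: integral_ge0 => x _; rewrite lee_fin.
  rewrite -FuFtD; apply: le_lt_trans Fu_fin; apply: ge0_subset_integral => //.
  - exact/measurable_EFinP.
  - by move=> x _; rewrite lee_fin.
have H_le : (\int[mu]_(x in H) (Fu x)%:E <= \int[mu]_(x in H) (Ft x)%:E)%E.
  by rewrite -(leeD2rE _ _ D_fin) -{1}FuFtD -!split_int.
have Ft_leB : (\int[mu]_(x in H) (Ft x)%:E <= B%:E * mu H)%E.
  rewrite -(integral_cst mu mH); apply: ae_ge0_le_integral => //.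
  - by move=> x _; rewrite lee_fin.
  - exact: mE.
  - by apply: filterS Ft_le => x xB /HO/xB; rewrite lee_fin.
apply: le_trans (le_trans H_le Ft_leB).
rewrite [leRHS](_ : _ = \int[mu]_(x in Omega) (\1_H x * Fu x)%:E)%E; last first.
  rewrite -{1}(setIidr HO) integral_mkcondr; apply: eq_integral => x _.
  by rewrite patchE indicE; case: (x \in H); rewrite ?mul1r ?mul0r.
have mhM : measurable_fun Omega (fun x => h x `^ p * (M < h x)%R%:R).
  apply: measurable_funM.
    exact: (measurableT_comp (measurable_powR p)).
  under eq_fun do rewrite mulrb.
  have mlt : measurable_fun Omega (fun x => M < h x).
    by apply: measurable_fun_ltr => //; exact: measurable_cst.
  by apply: measurable_fun_if => //; exact: measurable_cst.
apply: ae_ge0_le_integral => //.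
- by move=> x _; rewrite lee_fin mulr_ge0 ?powR_ge0.
- exact/measurable_EFinP.
- by move=> x _; rewrite lee_fin mulr_ge0// indicE.
- apply/measurable_EFinP; apply: measurable_funM; last exact: mFu.
  exact: measurable_funTS (measurable_indic mH).
- apply: filterS2 h_le hM_H => x hx Hx Ox; rewrite lee_fin.
  have [/(Hx Ox)|_] := ltP M (h x); last first.
    by rewrite mulr0 mulr_ge0// indicE.
  by move=> /mem_set; rewrite indicE => ->; rewrite mulr1 mul1r hx.
Qed.

(** * Null sets and Lebesgue spaces on the torus *)

Section torus_function_spaces.
Context {R : realType} {n : nat}.
Notation Rn := 'rV[R]_n.+1.
Notation L := (lebesgue_space R n).
Local Notation tm := (@torus_measure R n).

Lemma torus_ae_imply (P Q : L -> Prop) : (forall x, P x -> Q x) ->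
  {ae tm, forall x, P x} -> {ae tm, forall x, Q x}.
Proof. exact: (@filterS _ _ (ae_filter_ringOfSetsType tm)). Qed.

Lemma torus_ae_imply2 (P Q S : L -> Prop) : (forall x, P x -> Q x -> S x) ->
  {ae tm, forall x, P x} -> {ae tm, forall x, Q x} -> {ae tm, forall x, S x}.
Proof. exact: (@filterS2 _ _ (ae_filter_ringOfSetsType tm)). Qed.

(** Stated for arbitrary sets, on which [torus_measure] is an outer measure, so that it applies to
    superlevel sets of maximal functions. *)
Lemma torus_measure_le (X Y : set L) :
  {ae tm, forall x, X x -> Y x} -> (tm X <= tm Y)%E.
Proof.
case=> N [mN N0 XYN].
apply: (@le_trans _ _ (lebesgue_outer ((Y `&` cell) `|` (N `&` cell) : set Rn))).
  apply: le_lebesgue_outer => x [Xx xC]; have [Yx|Yx] := pselect (Y x).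
    by left.
  by right; split=> //; apply: XYN => /= /(_ Xx).
apply: (le_trans (outer_measureU2 _ _ _)).
by rewrite [X in (_ + X)%E](_ : _ = 0%E) ?adde0.
Qed.

Lemma torus_measure_fin (X : set L) : (tm X < +oo)%E.
Proof.
apply: le_lt_trans (@lebesgue_Rn_box R n 0 (const_mx 1)).
by apply: le_lebesgue_outer => x [].
Qed.

Lemma enorm_eq0 d (v : 'rV[R]_d) : enorm v = 0 -> v = 0.
Proof.
move=> v0; apply/rowP => i; rewrite mxE; apply/eqP; rewrite -normr_le0 -v0.
exact: coord_le_enorm.
Qed.

Lemma enorm0 d : enorm (0 : 'rV[R]_d) = 0.
Proof. by rewrite /enorm dotp0r sqrtr0. Qed.

Lemma enorm_patch d (Omega : set L) (v : Rn -> 'rV[R]_d) (x : Rn) :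
  patch (fun=> 0%E) Omega (fun x => (enorm (v x))%:E) x =
  (enorm (patch (fun=> 0) Omega v x))%:E.
Proof. by rewrite /patch; case: ifP => //= _; rewrite enorm0. Qed.

Lemma vmeasurable_patch d (Omega : set L) (v : Rn -> 'rV[R]_d) :
  measurable Omega -> vmeasurable Omega v ->
  vmeasurable setT (patch (fun=> 0) Omega v).
Proof.
move=> mO mv j.
rewrite (_ : (fun x => _) = (fun x => v x 0 j) \_ Omega); last first.
  by apply/funext => x; rewrite /patch; case: ifP => //= _; rewrite mxE.
exact: (iffLR (measurable_restrictT _ mO) (mv j)).
Qed.

Lemma Zn_periodic_patch d (Omega : set Rn) (v : Rn -> 'rV[R]_d) :
  Zn_periodic_set Omega -> Zn_periodic v ->
  Zn_periodic (patch (fun=> 0) Omega v).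
Proof.
move=> Op vp x z; rewrite /patch vp (_ : (_ \in Omega) = (x \in Omega))//.
by apply/idP/idP; rewrite !inE => /Op.
Qed.

Lemma LpNorm_finE d (Omega : set L) (r : R) (v : Rn -> 'rV[R]_d) : 0 < r ->
  (LpNorm Omega r%:E v < +oo)%E <->
  (\int[tm]_x (enorm (patch (fun=> 0%R) Omega v x) `^ r)%:E < +oo)%E.
Proof.
move=> r0.
have -> : (\int[tm]_x (enorm (patch (fun=> 0%R) Omega v x) `^ r)%:E)%E =
    (LpNorm Omega r%:E v `^ r)%E.
  rewrite /LpNorm poweR_Lnorm ?gt_eqF//; apply: eq_integral => x _.
  by rewrite enorm_patch /= ger0_norm ?sqrtr_ge0.
split => [|h]; first exact: poweR_lty.
rewrite -[LpNorm _ _ _]poweRe1 ?Lnorm_ge0// -(mulfV (lt0r_neq0 r0)) poweRrM.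
exact: poweR_lty.
Qed.

(** The norm at [+oo] is the essential supremum only for a nonzero measure, whence the positivity
    hypothesis. *)
Lemma LpNormy_le d (v : Rn -> 'rV[R]_d) (M : R) : (0 < tm setT)%E ->
  (LpNorm setT +oo v <= M%:E)%E -> {ae tm, forall x, enorm (v x) <= M}.
Proof.
move=> tm0; rewrite /LpNorm unlock tm0 => /ess_supP; apply: filterS => x /=.
by rewrite enorm_patch lee_fin ger0_norm ?sqrtr_ge0// /patch in_setT.
Qed.

Lemma inLpy_inLp d (Omega : set L) (r : R) (v : Rn -> 'rV[R]_d) :
  (0 < tm setT)%E -> measurable Omega -> 0 < r ->
  inLp setT +oo v -> inLp Omega r%:E v.
Proof.
move=> tm0 mO r0 [vp mv vfin].
have mvO : vmeasurable Omega v by move=> j; exact: measurable_funTS (mv j).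
split => //; apply/LpNorm_finE => //.
have v_fin : LpNorm setT +oo v \is a fin_num by rewrite ge0_fin_numE ?Lnorm_ge0.
have vM : (LpNorm setT +oo v <= (fine (LpNorm setT +oo v))%:E)%E by rewrite fineK.
move: vM; move: (fine _) => M /(LpNormy_le tm0) vM.
apply: (@le_lt_trans _ _ (\int[tm]_x (cst (M `^ r)%:E) x)%E).
  apply: ae_ge0_le_integral.
  - exact: measurableT.
  - by move=> x _; rewrite lee_fin powR_ge0.
  - apply/measurable_EFinP; apply: (measurableT_comp (measurable_powR r)).
    by apply: measurable_enorm; exact: vmeasurable_patch.
  - by move=> x _; rewrite lee_fin powR_ge0.
  - exact: measurable_cst.
  - apply: torus_ae_imply vM => x vxM _; rewrite lee_fin ge0_ler_powR ?nnegrE ?sqrtr_ge0//.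
    + exact: ltW.
    + by apply: le_trans vxM; rewrite sqrtr_ge0.
    + rewrite /patch; case: ifP => //= _; rewrite enorm0.
      by apply: le_trans vxM; rewrite sqrtr_ge0.
rewrite integral_cst//; apply: lte_mul_pinfty; rewrite ?lee_fin ?powR_ge0//.
exact: torus_measure_fin.
Qed.

End torus_function_spaces.

(** * Comparison of a minimiser with truncations of its extension *)

Section minimisers.
Context {R : realType} {n m l k : nat}.
Notation Rn := 'rV[R]_n.+1.
Notation L := (lebesgue_space R n).
Local Notation tm := (@torus_measure R n).
Variable A : multi_index n k -> 'M[R]_(m, l).
Variables (Omega : set Rn) (f : Rn -> 'rV[R]_m -> R) (p nu c : R).
Hypotheses (p1 : 1 < p) (oO : open Omega).
Hypotheses (f_integrand : integrand Omega f) (f_growth : growth Omega f p nu c).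

Let mO : measurable (Omega : set L). Proof. exact: measurable_open. Qed.

(** Growth makes the integrand nonnegative only almost everywhere; its positive part is nonnegative
    everywhere and has the same integral. *)
Let fpos (w : Rn -> 'rV[R]_m) : L -> R := fun x => Num.max 0 (f x (w x)).

Let fpos_ge0 w x : 0 <= fpos w x. Proof. by rewrite /fpos le_max lexx. Qed.

Let mf w : Zn_periodic w -> vmeasurable Omega w ->
  measurable_fun (Omega : set L) (fun x => f x (w x)).
Proof. exact: f_integrand.2. Qed.

Let mfpos w : Zn_periodic w -> vmeasurable Omega w ->
  measurable_fun (Omega : set L) (fpos w).
Proof.
by move=> wp mw; apply: measurable_maxr; [exact: measurable_cst|exact: mf].
Qed.

Let f_fpos w : {ae tm, forall x, Omega x -> f x (w x) = fpos w x}.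
Proof.
apply: torus_ae_imply f_growth => x fx /fx/(_ (w x))/andP[f_ge _].
by rewrite /fpos max_r// (le_trans _ f_ge)// powR_ge0.
Qed.

Let int_fpos w : Zn_periodic w -> vmeasurable Omega w ->
  (\int[tm]_(x in Omega) (f x (w x))%:E = \int[tm]_(x in Omega) (fpos w x)%:E)%E.
Proof.
move=> wp mw; apply: ae_eq_integral.
- exact: mO.
- by apply/measurable_EFinP; exact: mf.
- by apply/measurable_EFinP; exact: mfpos.
- by apply: torus_ae_imply (f_fpos w) => x fx Ox; rewrite fx.
Qed.

Let inLp0 : inLp Omega p%:E (fun=> 0 : 'rV[R]_m).
Proof.
have p0 : 0 < p by exact: lt_trans p1.
split => //; apply/LpNorm_finE => //; rewrite integral0_eq// => x _.
by rewrite /patch if_same enorm0 powR0// gt_eqF.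
Qed.

(** The zero function is an admissible competitor of finite energy; hence a minimiser has finite
    energy and is [A_free]. *)
Let functional0 : (functional A Omega f (fun=> 0%R) < +oo)%E.
Proof.
have p0 : 0 < p by exact: lt_trans p1.
have [per0 mea0 _] := inLp0.
rewrite /functional asboolT; last exact: A_free0.
rewrite int_fpos//.
apply: (@le_lt_trans _ _ (\int[tm]_(x in Omega) (cst `|c|%:E) x)%E).
  apply: ae_ge0_le_integral.
  - exact: mO.
  - by move=> x _; rewrite lee_fin.
  - by apply/measurable_EFinP; exact: mfpos.
  - by move=> x _; rewrite lee_fin.
  - exact: measurable_cst.
  - apply: torus_ae_imply f_growth => x fx /fx/(_ 0)/andP[_].
    rewrite enorm0 powR0 ?gt_eqF// mulr0 add0r lee_fin /fpos ge_max normr_ge0/=.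
    by move/le_trans; apply; exact: ler_norm.
rewrite integral_cst; last exact: mO.
apply: lte_mul_pinfty; rewrite ?lee_fin//; exact: torus_measure_fin.
Qed.

Lemma minimiser_A_free u : minimiser A Omega f p u -> A_free A Omega u.
Proof.
move=> [_ umin]; apply: contrapT => nAu.
have := umin _ inLp0; rewrite {1}/functional asboolF// leye_eq => /eqP h.
by have := functional0; rewrite h ltxx.
Qed.

Lemma minimiser_energy_fin u : minimiser A Omega f p u ->
  (functional A Omega f u < +oo)%E.
Proof. by move=> [_ umin]; exact: le_lt_trans (umin _ inLp0) functional0. Qed.

(** Where [enorm (u x)] exceeds [C * lam], [u] must differ from the bounded competitor [ut].
    Absolute values of [nu] and [c] keep the bound nonnegative whatever their signs. *)
Lemma minimiser_level_bound u ut C lam : (0 < tm setT)%E ->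
  minimiser A Omega f p u -> inLp setT +oo ut -> A_free A setT ut ->
  0 <= lam -> 0 <= C -> (LpNorm setT +oo ut <= (C * lam)%:E)%E ->
  (\int[tm]_(x in Omega) (enorm (u x) `^ p * (C * lam < enorm (u x))%R%:R)%:E <=
   (`|nu| * (C * lam) `^ p + `|c|)%:E *
   tm [set x | Omega x /\ u x <> ut x])%E.
Proof.
move=> tm0 umin utLy Aut lam0 C0 ut_le.
have p0 : 0 < p by exact: lt_trans p1.
have utL := inLpy_inLp tm0 mO p0 utLy.
have [[uper mu _] u_le] := umin; have [utper mut _] := utL.
have utM := LpNormy_le tm0 ut_le.
(* Writing the difference set through a norm makes it visibly measurable. *)
pose H : set L := Omega `&` [set x | 0 < enorm (u x - ut x)].
have uutE x : (0 < enorm (u x - ut x)) = (u x != ut x).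
  rewrite lt_neqAle sqrtr_ge0 andbT eq_sym; congr negb; apply/eqP/eqP => [/enorm_eq0|->].
    by move/eqP; rewrite subr_eq0 => /eqP.
  by rewrite subrr enorm0.
have HE : H = [set x | Omega x /\ u x <> ut x].
  by apply/seteqP; split => x [Ox] /=; rewrite ?uutE => uut; split=> //=;
     rewrite ?uutE; apply/eqP.
have mdiff : measurable_fun (Omega : set L) (fun x => enorm (u x - ut x)).
  apply: measurable_enorm => j; under eq_fun do rewrite !mxE.
  by apply: measurable_funB; [exact: mu|exact: mut].
rewrite -HE; apply: (@level_energy_bound _ _ _ _ _ _ _ (fpos u) (fpos ut)).
- exact: mO.
- rewrite /H (_ : [set x | _] = (fun x => enorm (u x - ut x)) @^-1` `]0, +oo[).
    by apply: mdiff => //; exact: mO.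
  by apply/seteqP; split => x /=; rewrite in_itv/= andbT.
- by move=> x [].
- exact: measurable_enorm.
- exact: mfpos.
- exact: mfpos.
- exact: fpos_ge0.
- exact: fpos_ge0.
- by rewrite addr_ge0// mulr_ge0// powR_ge0.
- apply: torus_ae_imply f_growth => x fx /fx/(_ (u x))/andP[h _].
  by rewrite /fpos le_max h orbT.
- apply: torus_ae_imply2 f_growth utM => x fx utx /fx/(_ (ut x))/andP[_ h].
  rewrite /fpos ge_max addr_ge0 ?mulr_ge0 ?powR_ge0//= (le_trans h)//.
  apply: lerD; last exact: ler_norm.
  apply: (@le_trans _ _ (`|nu| * enorm (ut x) `^ p)).
    by rewrite ler_wpM2r ?powR_ge0// ler_norm.
  by rewrite ler_wpM2l// ge0_ler_powR ?nnegrE ?sqrtr_ge0 ?mulr_ge0// ltW.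
- apply: torus_ae_imply utM => x utx Ox ux; split => //=.
  by rewrite uutE; apply: contraTneq ux => ->; rewrite -leNgt.
- move=> x Ox Hx; rewrite /fpos; congr (Num.max 0 (f x _)).
  by apply: contrapT => /eqP uut; apply: Hx; split => //=; rewrite uutE.
- rewrite -int_fpos//; have := minimiser_energy_fin umin.
  by rewrite /functional asboolT//; exact: minimiser_A_free umin.
- rewrite -!int_fpos//; have := u_le _ utL.
  rewrite /functional !asboolT//; first exact: A_free_restrict.
  exact: minimiser_A_free umin.
Qed.

(** The two alternatives of the extension property are merged: the larger factor [Num.max 1 C1] and
    the lower level [Num.min C2 C3^-1 * lam] serve for both. *)
Lemma minimiser_maximal_bound u CA C C1 C2 C3 lam :
  (0 < tm setT)%E -> 0 <= C -> CA <= C -> 0 < C1 -> 0 < C2 -> 0 < C3 -> 0 < lam ->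
  truncation_property A p CA -> extension_property A p Omega C1 C2 C3 ->
  minimiser A Omega f p u ->
  (\int[tm]_(x in Omega) (enorm (u x) `^ p * (C * lam < enorm (u x))%R%:R)%:E <=
   (`|nu| * (C * lam) `^ p + `|c|)%:E * ((Num.max 1 C1)%:E *
   tm [set x | ((Num.min C2 C3^-1 * lam)%:E <= maximal_on Omega u x)%E]))%E.
Proof.
move=> tm0 C0 CAC C10 C20 C30 lam0 trunc ext umin.
have [Ev [EvL Evu AEv alt]] := ext u umin.1 (minimiser_A_free umin).
have [ut [utL Aut ut_le Evut]] := trunc Ev EvL AEv lam lam0.
have ut_leC : (LpNorm setT +oo ut <= (C * lam)%:E)%E.
  by rewrite (le_trans ut_le)// lee_fin ler_wpM2r// ltW.
apply: (le_trans (minimiser_level_bound tm0 umin utL Aut (ltW lam0) C0 ut_leC)).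
apply: lee_wpmul2l.
  by rewrite lee_fin addr_ge0// mulr_ge0// powR_ge0.
have C1m : (0 <= (Num.max 1 C1)%:E)%E by rewrite lee_fin le_max ler01.
(* The set is kept inside [Omega], where alone the second alternative compares the maximal
   functions. *)
apply: (@le_trans _ _ (tm [set x | Omega x /\ (lam%:E <= maximal Ev x)%E])).
  apply: torus_measure_le; apply: torus_ae_imply2 Evu Evut => x Evu Evut [Ox uut].
  by split => //; apply: Evut; rewrite Evu.
case: alt => [alt1|alt2].
  apply: (@le_trans _ _ (tm [set x | (lam%:E <= maximal Ev x)%E])).
    by apply: torus_measure_le; apply: aeW => x [].
  apply: (le_trans (alt1 _ lam0)); apply: lee_pmul => //.
  - by rewrite lee_fin ltW.
  - by rewrite lee_fin le_max lexx orbT.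
  - apply: torus_measure_le; apply: aeW => x /=; apply: le_trans.
    by rewrite lee_fin ler_wpM2r ?(ltW lam0)// ge_min lexx.
apply: (@le_trans _ _ (tm
    [set x | ((Num.min C2 C3^-1 * lam)%:E <= maximal_on Omega u x)%E])).
  apply: torus_measure_le; apply: torus_ae_imply alt2 => x h [Ox lamE] /=.
  apply: (@le_trans _ _ (C3^-1%:E * lam%:E)%E).
    by rewrite lee_fin ler_wpM2r ?(ltW lam0)// ge_min lexx orbT.
  by rewrite lee_pdivrMl//; exact: le_trans lamE (h Ox).
rewrite -[leLHS]mul1e; apply: lee_wpmul2r => //.
by rewrite lee_fin le_max lexx.
Qed.

End minimisers.

(** * Higher integrability: estimates on the torus and choice of constants *)

Section higher_integrability.
Context {R : realType} {n : nat}.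
Notation Rn := 'rV[R]_n.+1.
Notation L := (lebesgue_space R n).
Local Notation tm := (@torus_measure R n).
Local Notation kappa := ((n.+2%:R * 7) ^+ n.+1 : R).

Lemma integral_torusT (h : L -> R) : measurable_fun setT h ->
  (forall x, 0 <= h x) ->
  (\int[tm]_x (h x)%:E = \int[lebesgue_Rn]_(x in (cell : set L)) (h x)%:E)%E.
Proof.
move=> mh h0; rewrite integral_torus ?setTI//; first exact/measurable_EFinP.
by move=> x _; rewrite lee_fin.
Qed.

Lemma integral_torus_powR_fin (h : L -> R) (p : R) : 1 <= p ->
  measurable_fun setT h -> (forall x, 0 <= h x) ->
  (\int[tm]_x (h x `^ p)%:E < +oo)%E -> (\int[tm]_x (h x)%:E < +oo)%E.
Proof.
move=> p1 mh h0 hp.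
have mhp : measurable_fun [set: L] (fun x => (h x `^ p)%:E).
  by apply/measurable_EFinP; exact: (measurableT_comp (measurable_powR p)).
apply: (@le_lt_trans _ _ (\int[tm]_x ((h x `^ p)%:E + cst 1%E x))%E).
  apply: ge0_le_integral.
  - exact: measurableT.
  - by move=> x _; rewrite lee_fin.
  - exact/measurable_EFinP.
  - by apply: emeasurable_funD => //; exact: measurable_cst.
  - move=> x _; rewrite -EFinD lee_fin; have [h1|/ltW h1] := leP (h x) 1.
      by rewrite (le_trans h1)// lerDr powR_ge0.
    by rewrite (le_trans (le1r_powR h1 p1))// lerDl.
rewrite ge0_integralD//; last by move=> x _; rewrite lee_fin powR_ge0.
rewrite integral_cst// mul1e; apply: lte_add_pinfty => //.
exact: torus_measure_fin.
Qed.

Lemma maximal_weak_type_torus m (g : Rn -> 'rV[R]_m) (s : R) :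
  Zn_periodic g -> vmeasurable setT g -> 0 < s ->
  (kappa%:E * \int[tm]_x (enorm (g x))%:E < (s / 2)%:E * tm setT)%E ->
  (tm [set x : Rn | s%:E <= maximal g x] <=
   (kappa * (4 / s) * (8 ^ n.+1)%:R)%:E *
   \int[tm]_x (enorm (g x) * (s / 4 < enorm (g x))%R%:R)%:E)%E.
Proof.
move=> gper mg s0.
have h0 x : 0 <= enorm (g x) by exact: sqrtr_ge0.
have mh : measurable_fun [set: L] (fun x => enorm (g x)) by exact: measurable_enorm.
rewrite integral_torusT// [tm setT](_ : _ = lebesgue_Rn (cell : set L)); last first.
  by rewrite /= /torus_measure/= /mrestr setTI.
move=> s_large; have := maximal_weak_type gper mg s0 s_large.
rewrite -integral_torusT; last 2 first.
- exact: measurable_cutoff.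
- by move=> x; case: ifP.
congr (_ <= _ * _)%E; apply: eq_integral => x _; congr EFin.
by rewrite mulrb; case: ifP; rewrite ?mulr1 ?mulr0.
Qed.

End higher_integrability.

Lemma powR_gt1_near (R : realType) (delta : R) : 0 < delta ->
  exists2 eps0, 0 < eps0 & forall eps, eps < eps0 -> 2 `^ eps < 1 + delta.
Proof.
move=> d0; have ln2 : 0 < ln (2 : R) by rewrite ln_gt0// ltr1n.
exists (ln (1 + delta) / ln 2); first by rewrite divr_gt0// ln_gt0// ltrDl.
move=> eps; rewrite ltr_pdivlMr// => lt_eps.
rewrite /powR pnatr_eq0/= -ltr_ln ?posrE ?expR_gt0 ?addr_gt0//.
by rewrite expRK.
Qed.

Theorem corollary4p3 (R : realType) (n m l : nat) (p CA nu C1 C2 C3 : R)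
    (p_gt1 : 1 < p) (C1_gt0 : 0 < C1) (C2_gt0 : 0 < C2) (C3_gt0 : 0 < C3) :
  exists eps0 : R, 0 < eps0 /\
    forall (k : nat) (A : multi_index n k -> 'M[R]_(m, l))
      (Omega : set 'rV[R]_n.+1) (f : 'rV[R]_n.+1 -> 'rV[R]_m -> R) (c : R)
      (u : 'rV[R]_n.+1 -> 'rV[R]_m),
    Zn_periodic_set Omega -> open Omega ->
    integrand Omega f ->
    growth Omega f p nu c ->
    truncation_property A p CA ->
    extension_property A p Omega C1 C2 C3 ->
    minimiser A Omega f p u ->
    forall eps : R, 0 < eps < eps0 -> inLp Omega (p + eps)%:E u.
Proof.
have p0 : 0 < p by lra.
pose kappa : R := (n.+2%:R * 7) ^+ n.+1.
(* Positive and at least [CA], whatever the sign of [CA]. *)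
pose C := `|CA| + 1.
have C0 : 0 < C by rewrite ltr_wpDl.
pose b0 := Num.min C2 C3^-1.
have b00 : 0 < b0 by rewrite lt_min C2_gt0 invr_gt0.
(* The weak-type estimate at level [b0 * lam] involves only values above a quarter of that level. *)
pose b := b0 / 4.
have bgt0 : 0 < b by rewrite divr_gt0.
pose W := kappa * (4 / b0) * (8 ^ n.+1)%:R.
have kappa0 : 0 <= kappa by rewrite exprn_ge0// mulr_ge0.
have W0 : 0 <= W by rewrite mulr_ge0// mulr_ge0// divr_ge0// ltW.
pose K := (`|nu| * C `^ p + 1) * Num.max 1 C1 * W.
have max0 : 0 <= Num.max 1 C1 by rewrite le_max ler01.
have K0 : 0 <= K.
  by rewrite mulr_ge0// mulr_ge0// addr_ge0// mulr_ge0// powR_ge0.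
have [e Cbe] : exists e : nat, C <= b * 2 ^+ e.
  exists (Num.truncn (C / b)).+1; rewrite -ler_pdivrMl// mulrC.
  have /andP[_ /ltW h] := truncn_itv (divr_ge0 (ltW C0) (ltW bgt0)).
  by apply: (le_trans h); rewrite -natrX ler_nat ltnW// ltn_expl.
pose Mc : R := 2 `^ (p - 1) / (2 `^ (p - 1) - 1) * b^-1 `^ (p - 1) * 2 ^+ e.
have Mc0 : 0 <= Mc.
  rewrite mulr_ge0 ?exprn_ge0// mulr_ge0 ?powR_ge0// divr_ge0 ?powR_ge0//.
  by rewrite subr_ge0 -[leLHS](powRr0 2) ler_powR ?ler1n// subr_ge0 ltW.
have KM0 : 0 <= K * Mc by rewrite mulr_ge0.
(* The bound [2]^ eps < 1 + delta[yields both]2 [^ eps <= 2] and the smallness condition for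
   absorption. *)
pose delta := Num.min 1 (2 * (K * Mc + 1))^-1.
have delta0 : 0 < delta by rewrite lt_min ltr01 invr_gt0 mulr_gt0// ltr_wpDl.
have delta1 : delta <= 1 by rewrite ge_min lexx.
have small : K * Mc * delta <= 2^-1.
  apply: (@le_trans _ _ (K * Mc * (2 * (K * Mc + 1))^-1)).
    by rewrite ler_wpM2l// ge_min lexx orbT.
  by rewrite ler_pdivrMr ?mulr_gt0 ?ltr_wpDl//; lra.
have [eps0 eps00 epsP] := @powR_gt1_near R delta delta0.
exists eps0; split => // k A Omega f c u per_O oO f_int f_growth trunc ext umin.
move=> eps /andP[eps_gt0 /epsP q_lt].
have [[u_per mu u_fin] _] := umin.
split => //; apply/LpNorm_finE; first by rewrite addr_gt0.
have mO := measurable_open oO.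
(* If the torus has measure zero, every integral over it vanishes. *)
have [tm0|tm0] := eqVneq (torus_measure [set: lebesgue_space R n]) 0%E.
  rewrite (eq_measure_integral mzero) ?integral_measure_zero// => X mX _.
  apply/eqP; rewrite eq_le measure_ge0 andbT [leRHS](_ : _ = 0%E)//.
  by rewrite -tm0; apply: torus_measure_le; apply: aeW.
have {}tm0 : (0 < torus_measure [set: lebesgue_space R n])%E.
  by rewrite lt_neqAle eq_sym tm0 measure_ge0.
pose g := patch (fun=> 0) Omega u.
have g_per : Zn_periodic g by exact: Zn_periodic_patch.
have mg : vmeasurable setT g by exact: vmeasurable_patch.
pose h : lebesgue_space R n -> R := fun x => enorm (g x).
have mh : measurable_fun setT h by exact: measurable_enorm.
have h0 x : 0 <= h x by exact: sqrtr_ge0.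
have hp_fin : (\int[torus_measure]_x (h x `^ p)%:E < +oo)%E by exact/LpNorm_finE.
have h_fin := integral_torus_powR_fin (ltW p_gt1) mh h0 hp_fin.
pose I := fine (\int[torus_measure]_x (h x)%:E)%E.
have IE : (\int[torus_measure]_x (h x)%:E = I%:E)%E.
  by rewrite fineK// ge0_fin_numE//; apply: integral_ge0 => x _; rewrite lee_fin.
pose mu0 := fine (torus_measure [set: lebesgue_space R n]).
have mu0E : torus_measure [set: lebesgue_space R n] = mu0%:E.
  by rewrite fineK// ge0_fin_numE ?ltW// torus_measure_fin.
have mu0_gt0 : 0 < mu0 by rewrite -lte_fin -mu0E.
pose lam0 := Num.max 1 (Num.max `|c| (2 * (kappa * I / (b0 * mu0)) + 1)).
have lam00 : 0 < lam0 by rewrite lt_max ltr01.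
apply: (@gehring_integrability _ _ _ torus_measure h mh h0 p C b K lam0 eps e) => //.
- exact: ltW.
- by move: q_lt delta1; move: (2 `^ eps) => q; lra.
- by move: q_lt small; move: (2 `^ eps) => q; rewrite -/Mc; nra.
move=> lam; rewrite !ge_max => /and3P[lam1 lamc lamI].
have lam_gt0 : 0 < lam by exact: lt_le_trans lam1.
have CAC : CA <= C by rewrite (le_trans (ler_norm _))// lerDl.
have bound := minimiser_maximal_bound p_gt1 oO f_int f_growth tm0 (ltW C0) CAC
  C1_gt0 C2_gt0 C3_gt0 lam_gt0 trunc ext umin.
have weak := @maximal_weak_type_torus R n m g (b0 * lam) g_per mg.
have s_gt0 : 0 < b0 * lam by rewrite mulr_gt0.
have s_large : (kappa%:E * \int[torus_measure]_x (enorm (g x))%:E <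
    (b0 * lam / 2)%:E * torus_measure [set: lebesgue_space R n])%E.
  rewrite IE mu0E -!EFinM lte_fin.
  have : kappa * I / (b0 * mu0) < lam / 2 by lra.
  by rewrite ltr_pdivrMr ?mulr_gt0//; lra.
rewrite [leLHS](_ : _ = \int[torus_measure]_(x in Omega)
    (enorm (u x) `^ p * (C * lam < enorm (u x))%R%:R)%:E)%E; last first.
  rewrite [RHS]integral_mkcond; apply: eq_integral => x _.
  rewrite patchE /h /g /patch; case: ifP => // _.
  by rewrite enorm0 powR0 ?mul0r// gt_eqF.
apply: (le_trans bound).
set Z := (\int[torus_measure]_x _)%E.
have Z0 : (0 <= Z)%E by apply: integral_ge0 => x _; rewrite lee_fin mulr_ge0.
have {}weak : (torus_measure [set x | (b0 * lam)%:E <= maximal_on Omega u x] <=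
    (kappa * (4 / (b0 * lam)) * (8 ^ n.+1)%:R)%:E * Z)%E.
  by have := weak s_gt0 s_large; rewrite [b0 * lam / 4]mulrAC.
apply: (@le_trans _ _ ((`|nu| * (C * lam) `^ p + `|c|)%:E * ((Num.max 1 C1)%:E *
    ((kappa * (4 / (b0 * lam)) * (8 ^ n.+1)%:R)%:E * Z)))%E).
  apply: lee_wpmul2l; first by rewrite lee_fin addr_ge0// mulr_ge0// powR_ge0.
  by apply: lee_wpmul2l; first by rewrite lee_fin.
rewrite !muleA -!EFinM; apply: lee_wpmul2r => //; rewrite lee_fin.
have lamp : `|nu| * (C * lam) `^ p + `|c| <= (`|nu| * C `^ p + 1) * (lam * lam `^ (p - 1)).
  rewrite mulr_powRB1 ?(ltW lam_gt0)// powRM ?(ltW C0) ?(ltW lam_gt0)// mulrDl mul1r mulrA.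
  rewrite lerD2l (le_trans lamc)//; exact: le1r_powR (ltW p_gt1).
apply: (@le_trans _ _ ((`|nu| * C `^ p + 1) * (lam * lam `^ (p - 1)) * Num.max 1 C1 *
   (kappa * (4 / (b0 * lam)) * (8 ^ n.+1)%:R))).
  rewrite ler_wpM2r//; last by rewrite ler_wpM2r.
  by rewrite mulr_ge0// mulr_ge0// divr_ge0// ltW.
rewrite le_eqVlt; apply/orP; left; apply/eqP; rewrite /K /W.
by field; rewrite !gt_eqF.
Qed.
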